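(* Let $H$ be a Hilbert space, $K=3$ or $K=4$, and let $L_1,\dots,L_K$ be closed subspaces of $H$ with $\bigcap_{k\in[K]}L_k=\{0\}$. The following statements are equivalent: (i) $L_1^{\perp}+\dots+L_K^{\perp}$ is closed in $H$; (ii) if $T=P(L_K)\cdots P(L_1)$, then there exist $C>0$ and $r\in[0,1)$ such that $\|T^n\|\leq Cr^n$ for all $n\in\mathbb N$; (iii) for all closed subspaces $\tilde L_i\subset L_i$, $i\in[K]$, each starting point $z_0\in H$ and every sequence of indices $k_1,k_2,\dots\in[K]$ containing each $k\in[K]$ infinitely often, the sequence of iterates defined by $z_n=P(\tilde L_{k_n})z_{n-1}$, $n\ge1$, converges in norm.
   Context: $[K]=\{1,\dots,K\}$. For a closed subspace $X$ of $H$, $P(X)$ is the orthogonal projection of $H$ onto $X$, and $X^\perp$ is its orthogonal complement in $H$. *)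

(* Defs.v *)
From HB Require Import structures.
From mathcomp Require Import all_boot all_order all_algebra.
From mathcomp Require Import sesquilinear complex.
From mathcomp Require Import all_classical all_reals all_analysis.

Set Implicit Arguments.
Unset Strict Implicit.
Unset Printing Implicit Defensive.

Import Order.TTheory GRing.Theory Num.Theory.
Import numFieldNormedType.Exports.

Local Open Scope classical_set_scope.
Local Open Scope ring_scope.

(* Hilbert spaces are taken over the real or the complex numbers; both cases  *)
(* are treated uniformly.                                                     *)
Variant scalar_kind := real_scalars | complex_scalars.

Definition scalars (R : realType) (s : scalar_kind) : numFieldType :=
  match s with
  | real_scalars => R
  | complex_scalars => R[i]
  end.

Definition scalar_conj (R : realType) (s : scalar_kind) :
    scalars R s -> scalars R s :=
  match s return scalars R s -> scalars R s with
  | real_scalars => idfun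
  | complex_scalars => @Num.conj R[i]
  end.

Definition scalar_re (R : realType) (s : scalar_kind) : scalars R s -> R :=
  match s return scalars R s -> R with
  | real_scalars => idfun
  | complex_scalars => @complex.Re R
  end.

(* {dot _ for _} is linear in its first argument and conjugate-linear in the  *)
(* second one.                                                                *)
Record hilbertType (R : realType) (s : scalar_kind) := HilbertType {
  hilbert_space :> completeNormedModType (scalars R s);
  inner : {dot hilbert_space for @scalar_conj R s};
  inner_norm : forall x : hilbert_space, `|x| ^+ 2 = inner x x
}.

Arguments inner {R s h}.

Section Hilbert.
Context {R : realType} {s : scalar_kind} {H : hilbertType R s}.
Implicit Types (X : set H) (A : H -> H).

Definition closed_subspace X : Prop :=
  GRing.submod_closed (mem X) /\ closed X.

Definition orthocomp X : set H :=
  [set y | forall x, X x -> inner x y = 0].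

(* For a closed subspace X, the point selected here exists and is unique; the *)
(* default value 0 is only reached when X is not a closed subspace.           *)
Definition proj X (x : H) : H :=
  xget 0 [set y | X y /\ orthocomp X (x - y)].

Definition set_sum (K : nat) (M : 'I_K -> set H) : set H :=
  [set x | exists v : 'I_K -> H, (forall k, M k (v k)) /\ x = \sum_k v k].

(* The norm of H is valued in the scalar field, on its nonnegative reals.     *)
Definition opnorm A : \bar R :=
  ereal_sup [set (scalar_re `|A x|)%:E | x in [set x : H | `|x| <= 1]].

(* foldl applies the projection onto the first subspace first: with the       *)
(* subspaces numbered from 1 to K this is P(L_K) ... P(L_1).                  *)
Definition proj_prod (K : nat) (L : 'I_K -> set H) (x : H) : H :=
  foldl (fun y k => proj (L k) y) x (enum 'I_K).

(* The indices used are k 1, k 2, ...; the value k 0 plays no role.           *)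
Fixpoint iterates (K : nat) (L : 'I_K -> set H) (k : nat -> 'I_K) (z0 : H)
    (n : nat) : H :=
  if n is m.+1 then proj (L (k n)) (iterates L k z0 m) else z0.

End Hilbert.

(* Main.v *)
(* Write [P_k] for the projection onto [L k].  The pivot of the proof is the
   regularity inequality [|x| <= c * sum_k |x - P_k x|].

   It is equivalent to (i) and to (ii): the displacement of a product of
   projections is controlled by the loss of norm, so regularity makes
   [P_K ... P_1] a strict contraction [T]; then [x = y - T y] is solvable and
   [y - T y] lies in the sum of the orthocomplements.  Conversely
   [|x - T^n x| <= n * sum_k |x - P_k x|] gives regularity back.

   Regularity implies (iii) because a word in two projections moves a point
   of the first subspace by at most the square root of its loss of squared norm.
   As there are at most four subspaces, beyond every time there is a window in
   which all indices occur and which is a single letter, a word in two letters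
   and a last letter.
   The end point of the window is close to all subspaces, relative to the loss
   of norm, so the norms cannot stay away from 0.

   If regularity fails, there are tuples of unit vectors [u a k] in [L k],
   orthogonal for different [a] and nearly independent of [k]; for two indices
   [i], [j] they differ, and powers of [P_i P_j P_i] kill them one after the
   other, as late in [a] as desired.  Inside a third subspace one chooses an
   orthonormal sequence [w_n] of combinations of the [u a l]: compressing the
   successive killings to the plane of [w_n] and [w_(n+1)] gives
   [1 - sum_(i <= j) beta_i g_i g_i^*] with [beta_i] increasing very fast, and
   high powers of these operators are nearly the projections onto a finely
   spaced sequence of lines turning from [w_n] to [w_(n+1)].  A point is thus
   transported along the [w_n] with almost no loss of norm, hence it does not
   converge to 0, the only possible limit.  The stages interfere only through
   the shared [w_n]; killing the tuples of odd stages earlier, with much smaller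
   [beta_i] than those of the neighbouring even stages, makes this harmless. *)

From HB Require Import structures.
Require Import Defs.
From mathcomp Require Import all_boot all_order all_algebra.
From mathcomp Require Import sesquilinear complex.
From mathcomp Require Import all_classical all_reals all_analysis.
From mathcomp Require Import zify ring lra.

Set Implicit Arguments.
Unset Strict Implicit.
Unset Printing Implicit Defensive.

Import Order.TTheory GRing.Theory Num.Theory.
Import numFieldNormedType.Exports.

Local Open Scope classical_set_scope.
Local Open Scope ring_scope.

(* [proj] alone is the coordinate projection of a product space. *)
Local Notation proj := Defs.proj.

(** * Scalars *)

Section Scalars.
Context {R : realType} {s : scalar_kind}.
Implicit Types (a b : scalars R s) (r t : R).

Definition of_real : R -> scalars R s :=
  match s return R -> scalars R s with
  | real_scalars => idfun
  | complex_scalars => real_complex R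
  end.

Lemma of_real_is_zmod_morphism : zmod_morphism of_real.
Proof. rewrite /of_real; case: s => //= x y; exact: rmorphB. Qed.

Lemma of_real_is_monoid_morphism : monoid_morphism of_real.
Proof.
rewrite /of_real; case: s => //=; split; first exact: rmorph1.
exact: rmorphM.
Qed.

HB.instance Definition _ :=
  GRing.isZmodMorphism.Build R (scalars R s) of_real of_real_is_zmod_morphism.
HB.instance Definition _ :=
  GRing.isMonoidMorphism.Build R (scalars R s) of_real of_real_is_monoid_morphism.

Lemma scalar_re_is_zmod_morphism : zmod_morphism (@scalar_re R s).
Proof. by rewrite /scalar_re; case: s => //= -[a b] [c d]. Qed.

HB.instance Definition _ :=
  GRing.isZmodMorphism.Build (scalars R s) R (@scalar_re R s)
    scalar_re_is_zmod_morphism.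

Lemma of_realK : cancel of_real (@scalar_re R s).
Proof. by rewrite /of_real /scalar_re; case: s. Qed.

Lemma ler_of_real : {mono of_real : r t / r <= t}.
Proof. by rewrite /of_real; case: s => //= r t; rewrite lecR. Qed.

Lemma ltr_of_real : {mono of_real : r t / r < t}.
Proof. by rewrite /of_real; case: s => //= r t; rewrite ltcR. Qed.

Lemma of_real_ge0 r : (0 <= of_real r) = (0 <= r).
Proof. by rewrite -(rmorph0 of_real) ler_of_real. Qed.

Lemma of_real_re_ge0 a : 0 <= a -> a = of_real (scalar_re a).
Proof.
move: a; rewrite /of_real /scalar_re; case: s => //= -[a b].
by rewrite lecE /= => /andP[/eqP -> _].
Qed.

Lemma scalar_reMl r a : scalar_re (of_real r * a) = r * scalar_re a.
Proof.
move: a; rewrite /of_real /scalar_re; case: s => //= -[a b] /=.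
by rewrite mul0r subr0.
Qed.

Lemma normr_of_real r : `|of_real r| = of_real `|r|.
Proof.
by rewrite /of_real; case: s => //=; rewrite normc_def /= expr0n addr0 sqrtr_sqr.
Qed.

Definition modulus a : R := scalar_re `|a|.

Lemma normrE_modulus a : `|a| = of_real (modulus a).
Proof. exact: of_real_re_ge0. Qed.

Lemma modulusM a b : modulus (a * b) = modulus a * modulus b.
Proof. by rewrite /modulus normrM {1}normrE_modulus scalar_reMl. Qed.

Lemma modulus_real r : modulus (of_real r) = `|r|.
Proof. by rewrite /modulus normr_of_real of_realK. Qed.

Lemma modulus_ge0 a : 0 <= modulus a.
Proof. by rewrite -of_real_ge0 -normrE_modulus. Qed.

Lemma modulus_eq0 a : (modulus a == 0) = (a == 0).
Proof.
by rewrite -(normr_eq0 a) normrE_modulus -(inj_eq (can_inj of_realK)) rmorph0.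
Qed.

Lemma scalar_re_le_modulus a : scalar_re a <= modulus a.
Proof.
rewrite /modulus; move: a; rewrite /scalar_re; case: s => /= [a|a]; first exact: ler_norm.
have := normc_ge_Re a; rewrite lecE => /andP[_] /=.
exact/le_trans/ler_norm.
Qed.

Lemma conj_is_zmod_morphism : zmod_morphism (@scalar_conj R s).
Proof. rewrite /scalar_conj; case: s => //= x y; exact: rmorphB. Qed.

Lemma conj_is_monoid_morphism : monoid_morphism (@scalar_conj R s).
Proof.
rewrite /scalar_conj; case: s => //=; split; [exact: rmorph1|exact: rmorphM].
Qed.

HB.instance Definition _ :=
  GRing.isZmodMorphism.Build (scalars R s) (scalars R s) (@scalar_conj R s)
    conj_is_zmod_morphism.
HB.instance Definition _ :=
  GRing.isMonoidMorphism.Build (scalars R s) (scalars R s) (@scalar_conj R s)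
    conj_is_monoid_morphism.

Lemma scalar_conjK : involutive (@scalar_conj R s).
Proof. rewrite /scalar_conj; case: s => //= x; exact: conjCK. Qed.

Lemma scalar_conj_real r : scalar_conj (of_real r) = of_real r.
Proof.
rewrite /scalar_conj /of_real; case: s => //=.
by apply/conj_Creal/complex_realP; exists r.
Qed.

Lemma mul_scalar_conj a : a * scalar_conj a = of_real (modulus a ^+ 2).
Proof.
have -> : of_real (modulus a ^+ 2) = `|a| ^+ 2 by rewrite normrE_modulus rmorphXn.
move: a.
rewrite /scalar_conj; case: s => /= a; last by rewrite normCK.
by rewrite real_normK ?num_real// expr2.
Qed.

Lemma scalar_re_conj a : scalar_re (scalar_conj a) = scalar_re a.
Proof. by rewrite /scalar_conj /scalar_re; case: s a => //= -[]. Qed.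

End Scalars.

(** * Hilbert spaces *)

Section HilbertBasics.
Context {R : realType} {s : scalar_kind} {H : hilbertType R s}.
Implicit Types (x y z : H) (a b : scalars R s) (r t e : R).

(** The norm of [H] lies in the scalar field; this real-valued copy makes the ordered field [R]
    available for all estimates. *)
Definition nrm x : R := scalar_re `|x|.
Definition rdot x y : R := scalar_re (inner x y).

Lemma normE_nrm x : `|x| = of_real (nrm x).
Proof. exact: of_real_re_ge0. Qed.

Lemma nrm_ge0 x : 0 <= nrm x.
Proof. by rewrite -(@of_real_ge0 _ s) -normE_nrm. Qed.

Lemma nrm_eq0 x : (nrm x == 0) = (x == 0).
Proof.
by rewrite -(normr_eq0 x) normE_nrm -(inj_eq (can_inj (@of_realK R s))) rmorph0.
Qed.

Lemma nrm_gt0 x : (0 < nrm x) = (x != 0).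
Proof. by rewrite lt_def nrm_ge0 andbT nrm_eq0. Qed.

Lemma nrm0 : nrm 0 = 0.
Proof. by apply/eqP; rewrite nrm_eq0. Qed.

Lemma nrmN x : nrm (- x) = nrm x.
Proof. by rewrite /nrm normrN. Qed.

Lemma nrm_distC x y : nrm (x - y) = nrm (y - x).
Proof. by rewrite -nrmN opprB. Qed.

Lemma ler_nrmD x y : nrm (x + y) <= nrm x + nrm y.
Proof.
by have := ler_normD x y; rewrite !normE_nrm -(rmorphD of_real) ler_of_real.
Qed.

Lemma ler_nrmB x y : nrm (x - y) <= nrm x + nrm y.
Proof. by rewrite -(nrmN y) ler_nrmD. Qed.

Lemma nrm_triangle y x z : nrm (x - z) <= nrm (x - y) + nrm (y - z).
Proof. by rewrite (le_trans _ (ler_nrmD _ _))// addrA subrK. Qed.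

Lemma ler_dist_nrm x y : nrm x <= nrm y + nrm (x - y).
Proof. by rewrite (le_trans _ (ler_nrmD _ _))// addrC subrK. Qed.

Lemma nrmZ a x : nrm (a *: x) = modulus a * nrm x.
Proof. by rewrite /nrm normrZ normrE_modulus scalar_reMl. Qed.

Lemma nrmZr r x : nrm (of_real r *: x) = `|r| * nrm x.
Proof. by rewrite nrmZ modulus_real. Qed.

Lemma ler_nrm_sum (I : Type) (l : seq I) (P : pred I) (f : I -> H) :
  nrm (\sum_(i <- l | P i) f i) <= \sum_(i <- l | P i) nrm (f i).
Proof.
elim/big_rec2: _ => [|i t x Pi le_xt]; first by rewrite nrm0.
by rewrite (le_trans (ler_nrmD _ _))// lerD2l.
Qed.

Lemma inner_self x : inner x x = of_real (nrm x ^+ 2).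
Proof. by rewrite -inner_norm normE_nrm rmorphXn. Qed.

Lemma inner0l y : inner 0 y = 0. Proof. exact: linear0l. Qed.
Lemma inner0r x : inner x 0 = 0. Proof. exact: linear0r. Qed.
Lemma innerDl x y z : inner (x + y) z = inner x z + inner y z.
Proof. exact: linearDl. Qed.
Lemma innerDr x y z : inner z (x + y) = inner z x + inner z y.
Proof. exact: linearDr. Qed.
Lemma innerNl x y : inner (- x) y = - inner x y.
Proof. exact: linearNl. Qed.
Lemma innerNr x y : inner x (- y) = - inner x y.
Proof. exact: linearNr. Qed.
Lemma innerBl x y z : inner (x - y) z = inner x z - inner y z.
Proof. by rewrite innerDl innerNl. Qed.
Lemma innerBr x y z : inner z (x - y) = inner z x - inner z y.
Proof. by rewrite innerDr innerNr. Qed.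
Lemma innerZl a x y : inner (a *: x) y = a * inner x y.
Proof. exact: linearZl_LR. Qed.
Lemma innerZr a x y : inner x (a *: y) = scalar_conj a * inner x y.
Proof. exact: linearZr_LR. Qed.
Lemma innerC x y : inner x y = scalar_conj (inner y x).
Proof. by rewrite [LHS]hermC expr0 mul1r. Qed.

Lemma inner_suml (I : Type) (l : seq I) (P : pred I) (f : I -> H) y :
  inner (\sum_(i <- l | P i) f i) y = \sum_(i <- l | P i) inner (f i) y.
Proof. exact: linear_sumlz. Qed.

Lemma inner_sumr (I : Type) (l : seq I) (P : pred I) (f : I -> H) y :
  inner y (\sum_(i <- l | P i) f i) = \sum_(i <- l | P i) inner y (f i).
Proof. exact: linear_sumr. Qed.

Lemma inner_eq0C x y : inner x y = 0 -> inner y x = 0.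
Proof. by rewrite innerC => /(congr1 (@scalar_conj R s)); rewrite scalar_conjK rmorph0. Qed.

Lemma rdotC x y : rdot x y = rdot y x.
Proof. by rewrite /rdot innerC scalar_re_conj. Qed.
Lemma rdotDl x y z : rdot (x + y) z = rdot x z + rdot y z.
Proof. by rewrite /rdot innerDl raddfD. Qed.
Lemma rdotBl x y z : rdot (x - y) z = rdot x z - rdot y z.
Proof. by rewrite /rdot innerBl raddfB. Qed.
Lemma rdotDr x y z : rdot z (x + y) = rdot z x + rdot z y.
Proof. by rewrite /rdot innerDr raddfD. Qed.
Lemma rdotBr x y z : rdot z (x - y) = rdot z x - rdot z y.
Proof. by rewrite /rdot innerBr raddfB. Qed.
Lemma rdot_self x : rdot x x = nrm x ^+ 2.
Proof. by rewrite /rdot inner_self of_realK. Qed.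
Lemma sqr_nrmD x y : nrm (x + y) ^+ 2 = nrm x ^+ 2 + 2 * rdot x y + nrm y ^+ 2.
Proof. rewrite -!rdot_self rdotDl !rdotDr (rdotC y x); ring. Qed.

Lemma sqr_nrmB x y : nrm (x - y) ^+ 2 = nrm x ^+ 2 - 2 * rdot x y + nrm y ^+ 2.
Proof. rewrite -!rdot_self rdotBl !rdotBr (rdotC y x); ring. Qed.

Lemma pythagoras x y : inner x y = 0 -> nrm (x + y) ^+ 2 = nrm x ^+ 2 + nrm y ^+ 2.
Proof. by move=> xy0; rewrite sqr_nrmD /rdot xy0 raddf0 mulr0 addr0. Qed.

(** The subtracted vector is the projection of [x] onto the line of [y]. The identity yields
    Cauchy-Schwarz, the optimality argument for projections and the rigidity of unit vectors with
    overlap 1. *)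
Lemma sqr_nrm_sub_line x y : y != 0 ->
  nrm (x - (of_real (nrm y ^- 2) * inner x y) *: y) ^+ 2 =
    nrm x ^+ 2 - modulus (inner x y) ^+ 2 / nrm y ^+ 2.
Proof.
move=> y0; have yp : 0 < nrm y by rewrite nrm_gt0.
set c := inner x y.
rewrite sqr_nrmB nrmZ /rdot innerZr -/c rmorphM /= scalar_conj_real.
rewrite -mulrA (mulrC _ c) mul_scalar_conj scalar_reMl of_realK modulusM modulus_real.
rewrite ger0_norm ?invr_ge0 ?exprn_ge0 ?nrm_ge0//.
by field; rewrite gt_eqF.
Qed.

Lemma cauchy_schwarz x y : modulus (inner x y) <= nrm x * nrm y.
Proof.
have [->|y0] := eqVneq y 0.
  by rewrite inner0r /modulus normr0 raddf0 nrm0 mulr0.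
rewrite -(@ler_pXn2r _ 2) ?nnegrE ?modulus_ge0 ?mulr_ge0 ?nrm_ge0//.
rewrite exprMn -ler_pdivrMr ?exprn_gt0 ?nrm_gt0//.
by rewrite -subr_ge0 -sqr_nrm_sub_line// sqr_ge0.
Qed.

End HilbertBasics.

(** * Limits, closures and submodules through the real-valued norm *)

Section Topology.
Context {R : realType} {s : scalar_kind} {H : hilbertType R s}.
Implicit Types (x y z : H) (X : set H) (r t e : R).

Lemma nrm_ltE x e : (nrm x < e) = (`|x| < of_real e).
Proof. by rewrite normE_nrm ltr_of_real. Qed.

Lemma posr_of_real (e : scalars R s) : 0 < e -> exists2 r : R, 0 < r & e = of_real r.
Proof.
move=> e0; exists (scalar_re e); last exact/of_real_re_ge0/ltW.
by rewrite -(@ltr_of_real _ s) rmorph0 -of_real_re_ge0// ltW.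
Qed.

Lemma closure_nrmP X y :
  closure X y <-> forall e, 0 < e -> exists2 x, X x & nrm (x - y) < e.
Proof.
split=> [Xy e e0|Xy B /nbhs_ballP[_/posr_of_real[e e0 ->] yB]].
  have /Xy[x [Xx]] : nbhs y (ball y (of_real e : scalars R s)).
    by apply/nbhsx_ballx; rewrite -(rmorph0 of_real) ltr_of_real.
  by rewrite -ball_normE /= -nrm_ltE nrm_distC; exists x.
have [x Xx xy] := Xy e e0; exists x; split=> //; apply: yB.
by rewrite -ball_normE /= -nrm_ltE nrm_distC.
Qed.

Lemma closed_nrmP X :
  closed X <-> forall y, (forall e, 0 < e -> exists2 x, X x & nrm (x - y) < e) -> X y.
Proof.
by split=> Xcl y => [/closure_nrmP/Xcl|/closure_nrmP/Xcl].
Qed.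

Definition limit (u : nat -> H) y :=
  forall e, 0 < e -> exists N, forall n, (N <= n)%N -> nrm (u n - y) < e.

Lemma cvgn_limit (u : nat -> H) y : u n @[n --> \oo] --> y <-> limit u y.
Proof.
split=> [uy e e0|uy].
  have e0' : 0 < of_real e :> scalars R s by rewrite -(rmorph0 of_real) ltr_of_real.
  move/cvgrPdist_lt : uy => /(_ _ e0')[N _ uN]; exists N => n /uN /=.
  by rewrite -nrm_ltE nrm_distC.
apply/cvgrPdist_lt => _/posr_of_real[e e0 ->].
have [N uN] := uy e e0; exists N => // n /uN /=.
by rewrite -nrm_ltE nrm_distC.
Qed.

Lemma cauchy_limit (u : nat -> H) :
    (forall e, 0 < e -> exists N, forall m n, (N <= m)%N -> (N <= n)%N ->
      nrm (u m - u n) < e) ->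
  exists y, limit u y.
Proof.
move=> cau; suff /cvg_ex[y uy] : cvgn u by exists y; exact/cvgn_limit.
apply/cauchy_cvgP/cauchyP => _/posr_of_real[e e0 ->].
have [N uN] := cau e e0; exists (u N); exists N => // n /= Nn.
by rewrite -ball_normE /= -nrm_ltE; exact: uN.
Qed.

Definition submod X := [/\ X 0, forall x y, X x -> X y -> X (x + y)
  & forall (a : scalars R s) x, X x -> X (a *: x)].

Lemma submodP X : GRing.submod_closed (mem X) <-> submod X.
Proof.
split=> [[]|[X0 XD XZ]].
  rewrite inE => X0 XZD; split=> // [x y Xx Xy|a x Xx].
    by have := XZD 1 x y; rewrite !inE scale1r; exact.
  by have := XZD a x 0; rewrite !inE addr0; exact.
split; first by rewrite inE.
by move=> a x y; rewrite !inE => Xx Xy; apply: XD => //; exact: XZ.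
Qed.

Lemma submodN X : submod X -> forall x, X x -> X (- x).
Proof. by move=> [_ _ XZ] x Xx; rewrite -scaleN1r; exact: XZ. Qed.

Lemma submodB X : submod X -> forall x y, X x -> X y -> X (x - y).
Proof. by move=> sX x y Xx /(submodN sX); case: (sX) => _ XD _; exact: XD. Qed.

Lemma submod_sum X (I : Type) (l : seq I) (P : pred I) (f : I -> H) :
  submod X -> (forall i, X (f i)) -> X (\sum_(i <- l | P i) f i).
Proof. by move=> [X0 XD _] Xf; elim/big_rec : _ => // i x _; exact: XD. Qed.

End Topology.

(** * Orthogonal projections and double orthocomplements *)

Section Projections.
Context {R : realType} {s : scalar_kind} {H : hilbertType R s}.
Implicit Types (x y z : H) (X : set H) (r t e : R).

(** A minimizing sequence for the distance from [x] to [X] is Cauchy by the parallelogram law. Its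
    limit lies in the closure, and optimality along every direction of [X] forces orthogonality. *)
Lemma ortho_decomposition X x :
  submod X -> exists2 y, closure X y & orthocomp X (x - y).
Proof.
move=> sX; have [X0 XD XZ] := sX.
pose D := [set nrm (x - z) | z in X]; pose d := inf D.
have D0 : D !=set0 by exists (nrm (x - 0)), 0.
have lbD : has_lbound D by exists 0 => _ [z _ <-]; exact: nrm_ge0.
have infD : has_inf D by [].
have le_d z : X z -> d <= nrm (x - z) by move=> Xz; apply: ge_inf => //; exists z.
have d0 : 0 <= d by apply: lb_le_inf => // _ [z _ <-]; exact: nrm_ge0.
have /choice[u uP] n : exists z, X z /\ nrm (x - z) < d + n.+1%:R^-1.
  have n0 : 0 < n.+1%:R^-1 :> R by rewrite invr_gt0.
  by have [_ [z Xz <-] lt_z] := inf_adherent n0 infD; exists z.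
have Xu n : X (u n) by have [] := uP n.
have lt_u n : nrm (x - u n) < d + n.+1%:R^-1 by have [] := uP n.
have parallelogram m n : nrm (u m - u n) ^+ 2 <=
    2 * nrm (x - u m) ^+ 2 + 2 * nrm (x - u n) ^+ 2 - 4 * d ^+ 2.
  have : d <= nrm (x - of_real 2^-1 *: (u m + u n)) by apply/le_d/XZ/XD.
  have -> : x - of_real 2^-1 *: (u m + u n) =
      of_real 2^-1 *: ((x - u m) + (x - u n)).
    have {1}-> : x = of_real 2^-1 *: (x + x).
      by rewrite -(mulr2n x) -(scaler_nat 2 x) scalerA
        -(rmorph_nat of_real) -rmorphM mulVf// rmorph1 scale1r.
    by rewrite -scalerBr opprD addrACA.
  rewrite nrmZr ger0_norm ?invr_ge0// => dle.
  have := sqr_nrmB (x - u n) (x - u m); rewrite opprB addrC addrA subrK.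
  have := sqr_nrmD (x - u m) (x - u n).
  have : (2 * d) ^+ 2 <= nrm (x - u m + (x - u n)) ^+ 2.
    by rewrite ler_pXn2r ?nnegrE ?mulr_ge0 ?nrm_ge0//; lra.
  by rewrite rdotC; nra.
have [y uy] : exists y, limit u y.
  apply: cauchy_limit => e e0.
  have [N] : exists N : nat, (4 * (2 * d + 1)) / e ^+ 2 < N.+1%:R.
    by exists (Num.truncn (4 * (2 * d + 1) / e ^+ 2)); rewrite truncnS_gt.
  rewrite ltr_pdivrMr ?exprn_gt0// => ltN.
  exists N => m n Nm Nn; rewrite -(@ltr_pXn2r _ 2) ?nnegrE ?nrm_ge0 ?ltW//.
  apply: le_lt_trans (parallelogram _ _) _.
  have bound k : (N <= k)%N -> nrm (x - u k) ^+ 2 <= d ^+ 2 + (2 * d + 1) * N.+1%:R^-1.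
    move=> Nk; pose a : R := N.+1%:R^-1.
    have a0 : 0 < a by rewrite invr_gt0.
    have a1 : a <= 1 by rewrite invf_le1// ler1n.
    have ka : nrm (x - u k) <= d + a.
      by rewrite (le_trans (ltW (lt_u k)))// lerD2l lef_pV2 ?posrE// ler_nat.
    rewrite (@le_trans _ _ ((d + a) ^+ 2))//; last by rewrite -/a; nra.
    by rewrite ler_pXn2r ?nnegrE ?nrm_ge0 ?addr_ge0// (ltW a0).
  have := bound m Nm; have := bound n Nn.
  have : 4 * ((2 * d + 1) / N.+1%:R) < e ^+ 2.
    by rewrite mulrA ltr_pdivrMr// (mulrC (e ^+ 2)).
  move: ((2 * d + 1) / N.+1%:R) => c; lra.
exists y.
  by apply/closure_nrmP => e /uy[N uN]; exists (u N); last exact: uN.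
have yd : nrm (x - y) <= d.
  apply/ler_addgt0Pr => e e0.
  have e2 : 0 < e / 2 by rewrite divr_gt0.
  have [N uN] := uy _ e2.
  have [M MP] : exists M : nat, M.+1%:R^-1 < e / 2.
    exists (Num.truncn (e / 2)^-1).
    by rewrite invf_plt ?posrE ?divr_gt0// truncnS_gt.
  pose k := maxn N M; have := uN k (leq_maxl N M).
  have : nrm (x - u k) < d + e / 2.
    apply: lt_le_trans (lt_u k) _; rewrite lerD2l (le_trans _ (ltW MP))//.
    by rewrite lef_pV2 ?posrE// ler_nat ltnS leq_maxr.
  by have := nrm_triangle (u k) x y; lra.
move=> z Xz; have [->|z0] := eqVneq z 0; first by rewrite inner0l.
apply: inner_eq0C; apply/eqP; rewrite -modulus_eq0.
set w := x - y.
(* Optimality makes [w] at least as short as its residual along [z], while [sqr_nrm_sub_line] makes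
   that residual strictly shorter unless [inner w z = 0]. *)
have : nrm w <= nrm (w - (of_real (nrm z ^- 2) * inner w z) *: z).
  apply: le_trans yd _; apply/ler_addgt0Pr => e /uy[N uN].
  set v := _ *: z.
  have /le_d := XD _ _ (Xu N) (XZ (of_real (nrm z ^- 2) * inner w z) _ Xz).
  rewrite -/v => /le_trans; apply.
  have -> : x - (u N + v) = (w - v) - (u N - y).
    by rewrite /w opprB opprD [RHS]addrA (addrAC (x - y)) subrK addrA addrAC.
  by rewrite (le_trans (ler_nrmB _ _))// lerD2l ltW// uN.
rewrite -(@ler_pXn2r _ 2) ?nnegrE ?nrm_ge0// sqr_nrm_sub_line//.
rewrite lerBrDr gerDl => h.
have : modulus (inner w z) ^+ 2 / nrm z ^+ 2 == 0.
  by rewrite eq_le h divr_ge0// sqr_ge0.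
by rewrite mulf_eq0 invr_eq0 !expf_eq0 /= nrm_eq0 (negbTE z0) orbF.
Qed.

Lemma closed_subspace_submod X : closed_subspace X -> submod X.
Proof. by case=> /submodP. Qed.

Section OneProjection.
Variables (X : set H) (hX : closed_subspace X).
Let sX : submod X := closed_subspace_submod hX.

Lemma projP x : X (proj X x) /\ orthocomp X (x - proj X x).
Proof.
rewrite /proj; case: xgetP => [y -> //|no]; exfalso.
have [y Xy Xoy] := ortho_decomposition x sX.
by apply: (no y); split=> //; apply: hX.2.
Qed.

Lemma proj_in x : X (proj X x). Proof. by have [] := projP x. Qed.

Lemma proj_ortho x : orthocomp X (x - proj X x). Proof. by have [] := projP x. Qed.

Lemma proj_unique x y : X y -> orthocomp X (x - y) -> proj X x = y.
Proof.
move=> Xy oy; have [Xp op] := projP x.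
have Xd : X (proj X x - y) by exact: submodB.
apply/eqP; rewrite -subr_eq0 -nrm_eq0 -sqrf_eq0 -rdot_self.
have {2}-> : proj X x - y = (x - y) - (x - proj X x) by rewrite opprB [RHS]addrC addrA subrK.
by rewrite /rdot innerBr oy// op// subrr raddf0.
Qed.

Lemma proj_id x : X x -> proj X x = x.
Proof. by move=> Xx; apply: proj_unique => // y _; rewrite subrr inner0r. Qed.

Lemma proj_idem x : proj X (proj X x) = proj X x.
Proof. exact/proj_id/proj_in. Qed.

Lemma proj0 : proj X 0 = 0.
Proof. by apply: proj_id; case: sX. Qed.

Lemma projD x y : proj X (x + y) = proj X x + proj X y.
Proof.
have [_ XD _] := sX; apply: proj_unique; first by apply: XD; exact: proj_in.
by move=> z Xz; rewrite opprD addrACA innerDr !proj_ortho// addr0.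
Qed.

Lemma projZ a x : proj X (a *: x) = a *: proj X x.
Proof.
have [_ _ XZ] := sX; apply: proj_unique; first exact/XZ/proj_in.
by move=> z Xz; rewrite -scalerBr innerZr proj_ortho// mulr0.
Qed.

Lemma projN x : proj X (- x) = - proj X x.
Proof. by rewrite -scaleN1r projZ scaleN1r. Qed.

Lemma projB x y : proj X (x - y) = proj X x - proj X y.
Proof. by rewrite projD projN. Qed.

Lemma inner_proj_in x y : X x -> inner x (proj X y) = inner x y.
Proof.
move=> Xx; apply/eqP; rewrite eq_sym -subr_eq0 -innerBr.
by rewrite proj_ortho.
Qed.

Lemma inner_proj x y : inner (proj X x) y = inner x (proj X y).
Proof.
rewrite -(inner_proj_in y (proj_in x)) innerC [RHS]innerC; congr scalar_conj.
exact/inner_proj_in/proj_in.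
Qed.

Lemma rdot_proj x y : rdot (proj X x) y = rdot x (proj X y).
Proof. by rewrite /rdot inner_proj. Qed.

Lemma rdot_proj_self x : rdot (proj X x) x = nrm (proj X x) ^+ 2.
Proof. by rewrite -rdot_self [RHS]rdot_proj proj_idem rdotC. Qed.

Lemma sqr_nrm_proj x : nrm x ^+ 2 = nrm (proj X x) ^+ 2 + nrm (x - proj X x) ^+ 2.
Proof. by rewrite -pythagoras ?proj_ortho//; [rewrite addrC subrK|exact: proj_in]. Qed.

Lemma nrm_proj_le x : nrm (proj X x) <= nrm x.
Proof.
by rewrite -(@ler_pXn2r _ 2) ?nnegrE ?nrm_ge0// (sqr_nrm_proj x) lerDl sqr_ge0.
Qed.

Lemma nrm_sub_proj_le x y : X y -> nrm (x - proj X x) <= nrm (x - y).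
Proof.
move=> Xy; rewrite -(@ler_pXn2r _ 2) ?nnegrE ?nrm_ge0// (sqr_nrm_proj (x - y)).
rewrite projB (proj_id Xy) opprB addrA subrK.
by rewrite lerDr sqr_ge0.
Qed.

End OneProjection.

Lemma orthocomp_closed_subspace X : closed_subspace (orthocomp X).
Proof.
split.
  apply/submodP; split=> [z _|x y ox oy z Xz|a x ox z Xz].
  - exact: inner0r.
  - by rewrite innerDr ox// oy// addr0.
  - by rewrite innerZr ox// mulr0.
apply/closed_nrmP => y oy x Xx; apply/eqP; rewrite -modulus_eq0 eq_le modulus_ge0 andbT.
apply/ler_addgt0Pr => e e0; rewrite add0r.
have n0 : 0 < nrm x + 1 by rewrite ltr_pwDr ?nrm_ge0.
have [z oz zy] := oy (e / (nrm x + 1)) (divr_gt0 e0 n0).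
have -> : inner x y = inner x (y - z) by rewrite innerBr oz// subr0.
apply: le_trans (cauchy_schwarz _ _) _.
have := nrm_ge0 x; move: zy; rewrite nrm_distC ltr_pdivlMr// => zy x0.
have := nrm_ge0 (y - z); nra.
Qed.

Lemma biorthocomp_id X : closed_subspace X -> orthocomp (orthocomp X) = X.
Proof.
move=> hX; rewrite eqEsubset; split=> [x oox|x Xx y oy]; last exact/inner_eq0C/oy.
have e : x - proj X x = 0.
  apply/eqP; rewrite -nrm_eq0 -sqrf_eq0 -rdot_self rdotBr.
  rewrite /rdot (oox _ (proj_ortho hX x)).
  by rewrite (inner_eq0C (proj_ortho hX x (proj_in hX x))) raddf0 subrr.
by rewrite -(subrK (proj X x) x) e add0r; exact: proj_in.
Qed.

(** With [sub_biorthocomp], this identifies the double orthocomplement with the closed span. *)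
Lemma biorthocomp_sub X A :
  closed_subspace X -> A `<=` X -> orthocomp (orthocomp A) `<=` X.
Proof.
move=> hX AX x oox; rewrite -(biorthocomp_id hX) => y oy.
by apply: oox => z /AX; exact: oy.
Qed.

Lemma sub_biorthocomp (A : set H) : A `<=` orthocomp (orthocomp A).
Proof. by move=> x Ax y oy; exact/inner_eq0C/oy. Qed.

Lemma proj_biorthocomp (A : set H) x y :
  orthocomp (orthocomp A) y -> orthocomp A (x - y) ->
  proj (orthocomp (orthocomp A)) x = y.
Proof.
move=> Ay oxy; apply: proj_unique => //; first exact: orthocomp_closed_subspace.
by move=> z oz; exact/inner_eq0C/oz.
Qed.

End Projections.

Lemma expr_small (R : realType) (r e : R) : 0 <= r -> r < 1 -> 0 < e ->
  exists N, forall n, (N <= n)%N -> r ^+ n < e.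
Proof.
move=> r0 r1 e0; have /cvgrPdist_lt/(_ e e0)[N _ hN] : r ^+ n @[n --> \oo] --> 0.
  by apply: cvg_expr; rewrite ger0_norm.
by exists N => n /hN /=; rewrite sub0r normrN ger0_norm// exprn_ge0.
Qed.

(** * Words in projections and regularity *)

Section Words.
Context {R : realType} {s : scalar_kind} {H : hilbertType R s}.
Implicit Types (x y z : H) (X : set H) (r t e : R).

Lemma geometric_limit (u : nat -> H) (C r : R) : 0 <= r -> r < 1 ->
  (forall n, nrm (u n.+1 - u n) <= C * r ^+ n) -> exists y, limit u y.
Proof.
move=> r0 r1 uC; have r1' : 0 < 1 - r by rewrite subr_gt0.
have C0 : 0 <= C by have := uC 0%N; rewrite expr0 mulr1; exact/le_trans/nrm_ge0.
have tail N k : nrm (u (N + k)%N - u N) <= C * r ^+ N * (1 - r ^+ k) / (1 - r).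
  elim: k => [|k ih]; first by rewrite addn0 subrr nrm0 expr0 subrr mulr0 mul0r.
  rewrite addnS (le_trans (nrm_triangle (u (N + k)%N) _ _))//.
  rewrite (le_trans (lerD (uC _) ih))// exprS exprD.
  by rewrite le_eqVlt; apply/orP; left; apply/eqP; field; rewrite gt_eqF.
apply: cauchy_limit => e e0.
have [N hN] : exists N, C * r ^+ N / (1 - r) < e / 2.
  have e1 : 0 < e / 2 * (1 - r) / (C + 1) by rewrite !divr_gt0 ?mulr_gt0 ?divr_gt0//; lra.
  have [N /(_ N (leqnn N)) hN] := expr_small r0 r1 e1; exists N.
  rewrite ltr_pdivrMr//; move: hN; rewrite ltr_pdivlMr; last by lra.
  by have := exprn_ge0 N r0; nra.
have near k : (N <= k)%N -> nrm (u k - u N) < e / 2.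
  move=> Nk; rewrite -(subnKC Nk) (le_lt_trans (tail _ _))//.
  rewrite (le_lt_trans _ hN)// ler_pM2r ?invr_gt0//.
  by rewrite ler_piMr ?mulr_ge0 ?exprn_ge0// gerBl exprn_ge0.
exists N => m n /near hm /near hn.
by have := nrm_triangle (u N) (u m) (u n); rewrite (nrm_distC (u N)); lra.
Qed.

Section Family.
Variables (K : nat) (L : 'I_K -> set H).
Hypothesis hL : forall k, closed_subspace (L k).
Implicit Types (l : seq 'I_K).

(** The head of the list acts first. [proj_prod] is the word [enum 'I_K], and every stretch of
    [iterates] is a word, so one calculus serves both. *)
Definition word l x := foldl (fun y k => proj (L k) y) x l.

Lemma word_cat l1 l2 x : word (l1 ++ l2) x = word l2 (word l1 x).
Proof. exact: foldl_cat. Qed.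

Lemma wordD l x y : word l (x + y) = word l x + word l y.
Proof. by elim: l x y => //= k l ih x y; rewrite projD// ih. Qed.

Lemma wordZ l a x : word l (a *: x) = a *: word l x.
Proof. by elim: l x => //= k l ih x; rewrite projZ// ih. Qed.

Lemma word0 l : word l 0 = 0.
Proof. by elim: l => //= k l; rewrite proj0. Qed.

Lemma wordB l x y : word l (x - y) = word l x - word l y.
Proof. by rewrite wordD -scaleN1r wordZ scaleN1r. Qed.

Lemma nrm_word_le l x : nrm (word l x) <= nrm x.
Proof. by elim: l x => //= k l ih x; exact/(le_trans (ih _))/nrm_proj_le. Qed.

(** Each letter subtracts a vector orthogonal to its subspace; the telescoping sum is collected by
    letters. *)
Lemma sub_word_in l x : set_sum (fun k => orthocomp (L k)) (x - word l x).
Proof.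
elim: l x => [|k l ih] x.
  exists (fun=> 0); split=> [k|]; last by rewrite big1// subrr.
  by move=> z _; exact: inner0r.
have [v [vL e]] := ih (proj (L k) x).
exists (fun j => v j + (if j == k then x - proj (L k) x else 0)); split=> [j z Lz|].
  rewrite innerDr vL// add0r; case: eqP => [<-|_]; last exact: inner0r.
  by rewrite proj_ortho; rewrite // -?jk.
rewrite big_split /= -big_mkcond big_pred1_eq -e.
by rewrite addrC addrA subrK.
Qed.

(** By Pythagoras each squared displacement is part of the loss of squared norm, so every step has
    length at most [d]. A point of [L k] is met after at most [size l] steps. *)
Lemma word_loss l x d : 0 <= d ->
    nrm x ^+ 2 - nrm (word l x) ^+ 2 <= d ^+ 2 ->
  forall k, k \in l -> nrm (x - proj (L k) x) <= (size l)%:R * d.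
Proof.
move=> d0; elim: l x => //= k l ih x loss j.
have pk := sqr_nrm_proj (hL k) x.
have lek : nrm (word l (proj (L k) x)) ^+ 2 <= nrm (proj (L k) x) ^+ 2.
  by rewrite ler_pXn2r ?nnegrE ?nrm_ge0// nrm_word_le.
have stepd : nrm (x - proj (L k) x) <= d.
  by rewrite -(@ler_pXn2r _ 2) ?nnegrE ?nrm_ge0//; lra.
have lossk : nrm (proj (L k) x) ^+ 2 - nrm (word l (proj (L k) x)) ^+ 2 <= d ^+ 2.
  by have := sqr_ge0 (nrm (x - proj (L k) x)); lra.
rewrite -natr1 mulrDl mul1r inE => /orP[/eqP -> |jl].
  by rewrite (le_trans stepd)// lerDr mulr_ge0.
apply: le_trans (nrm_sub_proj_le (hL j) _ (proj_in (hL j) (proj (L k) x))) _.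
apply: le_trans (nrm_triangle (proj (L k) x) _ _) _.
by rewrite [leLHS]addrC lerD// ih.
Qed.

Lemma sub_word_le l x :
  nrm (x - word l x) <= \sum_(k <- l) nrm (x - proj (L k) x).
Proof.
elim/last_ind: l x => [|l k ih] x; first by rewrite subrr nrm0 big_nil.
rewrite -cats1 word_cat big_cat big_seq1 /=.
apply: le_trans (nrm_triangle (proj (L k) x) _ _) _.
rewrite [leLHS]addrC lerD2r (le_trans _ (ih x))//.
by rewrite -projB// nrm_proj_le.
Qed.

Definition regular := exists c : R, forall x,
  nrm x <= c * \sum_k nrm (x - proj (L k) x).

Lemma sum_dist_ge0 x : 0 <= \sum_k nrm (x - proj (L k) x).
Proof. by apply: sumr_ge0 => k _; exact: nrm_ge0. Qed.

Lemma regular_gt0 : regular -> exists2 c : R, 0 < c & forall x,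
  nrm x <= c * \sum_k nrm (x - proj (L k) x).
Proof.
move=> [c hc]; exists (Num.max c 1); first by rewrite lt_max ltr01 orbT.
move=> x; rewrite (le_trans (hc x))// ler_wpM2r ?sum_dist_ge0//.
by rewrite le_max lexx.
Qed.

(** With [d ^+ 2] the loss of squared norm under the product, [word_loss] and regularity give
    [nrm x <= b * d], which rearranges to a contraction factor below 1. *)
Lemma regular_contraction : regular -> exists r : R, [/\ 0 <= r, r < 1 &
  forall x, nrm (proj_prod L x) <= r * nrm x].
Proof.
move=> /regular_gt0[c c0 hc].
(* There are [K] subspaces, each met within a word of length [K]; the summand 1 ensures [1 <= b]. *)
pose b : R := c * (K%:R * K%:R) + 1.
have b1 : 1 <= b by rewrite lerDr !mulr_ge0// ltW.
have b0 : 0 < b by rewrite (lt_le_trans ltr01).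
exists (Num.sqrt (1 - (b ^+ 2)^-1)).
have b2 : (b ^+ 2)^-1 <= 1 by rewrite invf_le1 ?exprn_gt0// exprn_ege1.
split; first exact: sqrtr_ge0.
  rewrite -[ltRHS]sqrtr1 ltr_sqrt// gtrBl invr_gt0 exprn_gt0//.
move=> x.
pose d := Num.sqrt (nrm x ^+ 2 - nrm (proj_prod L x) ^+ 2).
have loss0 : 0 <= nrm x ^+ 2 - nrm (proj_prod L x) ^+ 2.
  by rewrite subr_ge0 ler_pXn2r ?nnegrE ?nrm_ge0// nrm_word_le.
have d2 : d ^+ 2 = nrm x ^+ 2 - nrm (proj_prod L x) ^+ 2 by rewrite sqr_sqrtr.
have d0 : 0 <= d by exact: sqrtr_ge0.
have xd : nrm x <= b * d.
  rewrite (le_trans (hc x))//.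
  have : \sum_k nrm (x - proj (L k) x) <= K%:R * (K%:R * d).
    apply: (@le_trans _ _ (\sum_(k < K) K%:R * d)); last first.
      by rewrite sumr_const card_ord -[leLHS]mulr_natl.
    apply: ler_sum => k _.
    have := @word_loss (enum 'I_K) x d d0; rewrite d2 size_enum_ord.
    by move=> /(_ (lexx _) k); rewrite mem_enum; exact.
  by rewrite /b; nra.
rewrite -(@ler_pXn2r _ 2) ?nnegrE ?mulr_ge0 ?sqrtr_ge0 ?nrm_ge0//.
rewrite exprMn sqr_sqrtr ?subr_ge0//.
have : nrm x ^+ 2 / b ^+ 2 <= d ^+ 2.
  rewrite ler_pdivrMr ?exprn_gt0// mulrC -exprMn ler_pXn2r ?nnegrE ?nrm_ge0//.
  by rewrite mulr_ge0// ltW.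
by rewrite d2 mulrBl mul1r mulrC; lra.
Qed.

End Family.
End Words.

(** * Regularity, decay of powers and the sum of orthocomplements *)

Section PowerDecay.
Context {R : realType} {s : scalar_kind} {H : hilbertType R s}.
Variables (K : nat) (L : 'I_K -> set H).
Hypothesis hL : forall k, closed_subspace (L k).
Implicit Types (x y z : H) (r t e : R).

Lemma nrm_le1 x : (`|x| <= 1) = (nrm x <= 1).
Proof. by rewrite normE_nrm -(rmorph1 of_real) ler_of_real. Qed.

Lemma opnorm_leP (A : H -> H) r :
  (opnorm A <= r%:E)%E <-> forall x, nrm x <= 1 -> nrm (A x) <= r.
Proof.
split=> [Ar x x1|Ar].
  rewrite -lee_fin; apply: le_trans Ar; apply: ereal_sup_ubound.
  by exists x; rewrite //= nrm_le1.
by apply: ge_ereal_sup => _ [x /= + <-]; rewrite nrm_le1 lee_fin; exact: Ar.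
Qed.

Lemma iter_proj_prod_word n x :
  iter n (proj_prod L) x = word L (flatten (nseq n (enum 'I_K))) x.
Proof.
elim: n => //= n ->; rewrite /proj_prod -/(word L _ _) -word_cat.
by congr word; elim: n => [|n ih] /=; rewrite ?cats0// -catA ih.
Qed.

Lemma regular_power_decay : regular L -> exists C r : R,
  [/\ 0 < C, 0 <= r, r < 1 &
    forall n, (opnorm (iter n (proj_prod L)) <= (C * r ^+ n)%:E)%E].
Proof.
move=> /(regular_contraction hL)[r [r0 r1 hr]]; exists 1, r; split=> // n.
apply/opnorm_leP => x x1; rewrite mul1r; elim: n => [|n ih] //=.
by rewrite (le_trans (hr _))// exprS ler_wpM2l.
Qed.

(** A power of norm at most 1/2 leaves at least half of the length of [x] in its displacement, and
    [sub_word_le] bounds that displacement by [n] times the sum of distances. *)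
Lemma power_decay_regular (C r : R) : 0 < C -> 0 <= r -> r < 1 ->
  (forall n, (opnorm (iter n (proj_prod L)) <= (C * r ^+ n)%:E)%E) -> regular L.
Proof.
move=> C0 r0 r1 hT; have e0 : 0 < (2 * C)^-1 by rewrite invr_gt0 mulr_gt0.
have [n /(_ n (leqnn n)) rn] := expr_small r0 r1 e0.
have Tn x : nrm (iter n (proj_prod L) x) <= 2^-1 * nrm x.
  have [->|x0] := eqVneq x 0.
    by rewrite iter_proj_prod_word word0// nrm0 mulr0.
  have xp : 0 < nrm x by rewrite nrm_gt0.
  have /opnorm_leP/(_ (of_real (nrm x)^-1 *: x)) := hT n.
  rewrite nrmZr ger0_norm ?invr_ge0 ?nrm_ge0// mulVf ?gt_eqF// => /(_ (lexx _)).
  rewrite !iter_proj_prod_word wordZ// nrmZr ger0_norm ?invr_ge0 ?nrm_ge0//.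
  rewrite mulrC ler_pdivrMr// => /le_trans; apply; rewrite ler_pM2r//.
  have : (2 * C)^-1 = 2^-1 / C by rewrite invfM.
  move=> e; move: rn; rewrite e ltr_pdivlMr// mulrC; exact: ltW.
exists (2 * n%:R) => x.
have : nrm (x - iter n (proj_prod L) x) <= n%:R * \sum_k nrm (x - proj (L k) x).
  rewrite iter_proj_prod_word (le_trans (sub_word_le hL _ _))//.
  elim: n {rn Tn} => [|n ih] /=; first by rewrite big_nil mul0r.
  by rewrite big_cat /= -natr1 mulrDl mul1r addrC lerD// big_enum.
have := Tn x; have := ler_dist_nrm x (iter n (proj_prod L) x).
move: (\sum_k _) => S; lra.
Qed.

(** The equation [x = y - T y] is solved by the Neumann iteration [u], which converges because [T]
    is a strict contraction. *)
Lemma regular_sum_setT : regular L -> set_sum (fun k => orthocomp (L k)) = setT.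
Proof.
move=> /(regular_contraction hL)[r [r0 r1 hr]]; rewrite -subTset => x _.
pose T := proj_prod L.
have TB y z : T (y - z) = T y - T z by exact: wordB.
pose u n := iter n (fun y => x + T y) 0.
have [y uy] : exists y, limit u y.
  apply: (@geometric_limit _ _ _ _ (nrm x) r) => //.
  elim=> [|n ih]; first by rewrite /u /= /T /proj_prod -/(word L _ _) word0// addr0 subr0 expr0 mulr1.
  have -> : u n.+2 - u n.+1 = (x + T (u n.+1)) - (x + T (u n)) by [].
  rewrite opprD addrACA subrr add0r -TB (le_trans (hr _))//.
  by rewrite exprS mulrCA ler_wpM2l.
suff -> : x = y - T y by exact: sub_word_in.
apply/eqP; rewrite -subr_eq0 -nrm_eq0 eq_le nrm_ge0 andbT.
apply/ler_addgt0Pr => e e0; rewrite add0r.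
have e2 : 0 < e / 2 by rewrite divr_gt0.
have [N hN] := uy _ e2.
have -> : x - (y - T y) = (u N.+1 - y) - T (u N - y).
  have -> : u N.+1 = x + T (u N) by [].
  by rewrite TB !opprB (addrAC x) -[RHS]addrA (addrC (T (u N))) subrK -addrA (addrC (- y)).
have := ler_nrmB (u N.+1 - y) (T (u N - y)).
have := hN N (leqnn N); have := hN N.+1 (leqnSn N).
have := nrm_word_le hL (enum 'I_K) (u N - y); rewrite -/(proj_prod L _) -/T.
lra.
Qed.

End PowerDecay.

(** * Convergence of arbitrary iterates *)

Section TwoLetters.
Context {R : realType} {s : scalar_kind} {H : hilbertType R s}.
Variables (A B : set H) (hA : closed_subspace A) (hB : closed_subspace B).
Variable x : H.
Hypothesis Ax : A x.

(** Adjacent repetitions in a two-letter word act trivially, so every such word applied to [x] gives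
    a term of this sequence. *)
Fixpoint alternate n : H :=
  if n is m.+1 then (if odd m then proj A (alternate m) else proj B (alternate m))
  else x.

Lemma alternate_in n : (if odd n then B else A) (alternate n).
Proof.
by case: n => //= n; case: (odd n); [exact: proj_in|exact: proj_in].
Qed.

Lemma proj_alternate (b : bool) n : exists m,
  proj (if b then A else B) (alternate n) = alternate m.
Proof.
have := alternate_in n; have [on|on] := boolP (odd n); case: b => h.
- by exists n.+1; rewrite /= on.
- by exists n; rewrite proj_id.
- by exists n; rewrite proj_id.
- by exists n.+1; rewrite /= (negbTE on).
Qed.

Lemma nrm_alternateS n : nrm (alternate n.+1) <= nrm (alternate n).
Proof. by rewrite /=; case: ifP => _; exact: nrm_proj_le. Qed.

(** Self-adjointness moves the outer projection of [alternate j.+1] over to [alternate i]; parity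
    decides whether it is the identity there or produces [alternate i.+1]. *)
Lemma rdot_alternateS i j :
  rdot (alternate i) (alternate j.+1) =
  if odd i == odd j then rdot (alternate i.+1) (alternate j)
  else rdot (alternate i) (alternate j).
Proof.
have := alternate_in i; rewrite /=.
case: (odd i); case: (odd j) => /= h.
- by rewrite rdot_proj.
- by rewrite -rdot_proj// proj_id.
- by rewrite -rdot_proj// proj_id.
- by rewrite rdot_proj.
Qed.

(** Strong induction on the gap [d]: [rdot_alternateS] shortens it by one or two, and norms only
    grow when the last index goes back. A gap of one is settled directly. *)
Lemma rdot_alternate_ge d i :
  nrm (alternate (i + d)) ^+ 2 <= rdot (alternate i) (alternate (i + d)).
Proof.
have [n] := ubnP d; elim: n d i => // n ih [|d] i dn.
  by rewrite addn0 rdot_self.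
have le_sq : nrm (alternate (i + d).+1) ^+ 2 <= nrm (alternate (i + d)) ^+ 2.
  by rewrite ler_pXn2r ?nnegrE ?nrm_ge0// nrm_alternateS.
rewrite addnS rdot_alternateS oddD; case: d => [|d] in dn le_sq *.
  rewrite addn0 /= addbF eqxx (_ : rdot _ _ = nrm (alternate i.+1) ^+ 2)//=.
  by case: ifP => _; rewrite rdot_proj_self.
case: ifP => _.
  apply: le_trans le_sq _; rewrite -addSnnS; apply: ih.
  by rewrite -ltnS (leq_trans _ dn).
by apply: le_trans le_sq _; exact: ih.
Qed.

(** The bound is uniform in [n], so that arbitrarily long two-letter words are harmless. *)
Lemma alternate_displacement n :
  nrm (x - alternate n) ^+ 2 <= nrm x ^+ 2 - nrm (alternate n) ^+ 2.
Proof. by rewrite sqr_nrmB; have := rdot_alternate_ge n 0; rewrite add0n /=; lra. Qed.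

End TwoLetters.

Lemma card_le2_pair (T : finType) (t0 : T) (A : {set T}) :
  (#|A| <= 2)%N -> exists a b, forall x, x \in A -> x = a \/ x = b.
Proof.
move=> A2; have [->|[a aA]] := set_0Vmem A.
  by exists t0, t0 => x; rewrite inE.
have [A0|[b bA]] := set_0Vmem (A :\ a).
  exists a, a => x xA; left; apply/eqP; apply: contraT => xa.
  have : x \in A :\ a by rewrite !inE xa xA.
  by rewrite A0 inE.
exists a, b => x xA; have [->|xa] := eqVneq x a; first by left.
right; apply/eqP; apply: contraT => xb.
have : (#|[set a; b; x]%SET| <= #|A|)%N.
  apply/subset_leq_card/fintype.subsetP => y; rewrite !inE -orbA.
  by move: bA; rewrite !inE => /andP[_ bA] /or3P[] /eqP ->.
move=> /leq_trans/(_ A2); rewrite -finset.setUA cardsU1 cards2 !inE.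
move: bA; rewrite !inE => /andP[ba _].
by rewrite eq_sym (negbTE ba) eq_sym (negbTE xa) eq_sym xb.
Qed.

(** * Windows of an index sequence with two inner letters *)

Section Windows.
Context {R : realType} {s : scalar_kind} {H : hilbertType R s}.
Variables (K : nat) (M : 'I_K -> set H).
Hypothesis hM : forall k, closed_subspace (M k).

Lemma word_alternate (i j : 'I_K) x (l : seq 'I_K) : M i x ->
    (forall k, k \in l -> k = i \/ k = j) ->
  exists n, word M l x = alternate (M i) (M j) x n.
Proof.
move=> Mx; elim/last_ind: l => [|l k ih] lij; first by exists 0%N.
have [n e] : exists n, word M l x = alternate (M i) (M j) x n.
  by apply: ih => k' kl; apply: lij; rewrite mem_rcons inE kl orbT.
have kij : k = i \/ k = j by apply: lij; rewrite mem_rcons mem_head.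
rewrite -cats1 word_cat e /=; case: kij => ->.
- exact: (proj_alternate (hM i) (hM j) Mx true n).
- exact: (proj_alternate (hM i) (hM j) Mx false n).
Qed.

Lemma two_letter_displacement (i j : 'I_K) x (l : seq 'I_K) : M i x ->
    (forall k, k \in l -> k = i \/ k = j) ->
  nrm (x - word M l x) ^+ 2 <= nrm x ^+ 2 - nrm (word M l x) ^+ 2.
Proof. by move=> Mx /(word_alternate Mx)[n ->]; exact: alternate_displacement. Qed.

Variables (k : nat -> 'I_K) (z0 : H).
Local Notation z := (iterates M k z0).

Lemma iterates_word p m :
  z (p + m) = word M [seq k i | i <- iota p.+1 m] (z p).
Proof.
elim: m => [|m ih]; first by rewrite addn0.
by rewrite -(addn1 m) iotaD map_cat word_cat -ih addn1 addnS /= addSn.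
Qed.

Lemma iterates_in n : M (k n.+1) (z n.+1).
Proof. exact: proj_in. Qed.

Lemma nrm_iterates_le p q : (p <= q)%N -> nrm (z q) <= nrm (z p).
Proof. by move=> /subnKC <-; rewrite iterates_word nrm_word_le. Qed.

(** The path from [z p.+1] to [z q] is one step, a two-letter word started at [z p.+2], which
    already lies in one of the two subspaces, and a last step; each has length at most [d]. *)
Lemma window_dist p q (a b : 'I_K) (d : R) : 0 <= d ->
    nrm (z p) ^+ 2 - nrm (z q) ^+ 2 <= d ^+ 2 ->
    (forall i, (p.+1 < i < q)%N -> k i = a \/ k i = b) ->
  forall n, (p < n <= q)%N -> nrm (z q - z n) <= 5 * d.
Proof.
move=> d0 loss ab n /andP[pn nq].
have lossd i j : (p <= i)%N -> (i <= j)%N -> (j <= q)%N ->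
    nrm (z i) ^+ 2 - nrm (z j) ^+ 2 <= d ^+ 2.
  move=> pi ij jq; apply: le_trans loss; rewrite lerB//.
    by rewrite ler_pXn2r ?nnegrE ?nrm_ge0// nrm_iterates_le.
  by rewrite ler_pXn2r ?nnegrE ?nrm_ge0// nrm_iterates_le.
have step i : (p <= i)%N -> (i < q)%N -> nrm (z i - z i.+1) <= d.
  move=> pi iq; rewrite -(@ler_pXn2r _ 2) ?nnegrE ?nrm_ge0//.
  have := lossd i i.+1 pi (leqnSn i) iq.
  by rewrite (sqr_nrm_proj (hM (k i.+1)) (z i)) -/(z i.+1); lra.
have inner_dist m : (p < m)%N -> (m < q)%N -> nrm (z p.+1 - z m) <= 2 * d.
  rewrite leq_eqVlt => /orP[/eqP <- _|pm mq].
    by rewrite subrr nrm0 mulr_ge0.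
  rewrite (le_trans (nrm_triangle (z p.+2) _ _))// mulr_natl lerD//.
    by apply: step => //; exact: ltn_trans mq.
  rewrite -(@ler_pXn2r _ 2) ?nnegrE ?nrm_ge0//.
  apply: le_trans (lossd p.+2 m _ _ (ltnW mq)) => //; last by rewrite ltnW.
  rewrite -(subnKC pm) iterates_word.
  have [j hj] : exists j, forall i, i \in [seq k i | i <- iota p.+3 (m - p.+2)] ->
      i = k p.+2 \/ i = j.
    have : k p.+2 = a \/ k p.+2 = b by apply: ab; rewrite ltnSn (leq_ltn_trans pm).
    have abl i : i \in [seq k i | i <- iota p.+3 (m - p.+2)] -> i = a \/ i = b.
      move=> /mapP[i0]; rewrite mem_iota addSn subnKC// ltnS => /andP[i1 i2] ->.
      by apply: ab; rewrite (ltnW i1) (leq_ltn_trans i2).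
    by case=> ->; [exists b|exists a] => i /abl[]; [left|right|right|left].
  exact: two_letter_displacement (iterates_in _) hj.
move: nq; rewrite leq_eqVlt => /orP[/eqP ->|nq].
  by rewrite subrr nrm0 mulr_ge0.
case: q => // q in loss ab lossd step inner_dist nq *.
have pq : (p < q.+1)%N by exact: ltn_trans nq.
have qp1 : nrm (z q - z p.+1) <= 2 * d.
  move: pq; rewrite ltnS leq_eqVlt => /orP[/eqP e|pq].
    by have := leq_trans pn nq; rewrite e ltnn.
  by rewrite nrm_distC inner_dist.
(* Going from [z q.+1] through [z q] and [z p.+1] to [z n] costs [d], [2 * d] and [2 * d]; hence the
   constant 5. *)
have := inner_dist n pn nq.
have : nrm (z q - z q.+1) <= d by apply: step; rewrite // -ltnS.
have := nrm_triangle (z q) (z q.+1) (z n).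
have := nrm_triangle (z p.+1) (z q) (z n).
by rewrite (nrm_distC (z q.+1) (z q)); lra.
Qed.

Hypothesis hk : forall j : 'I_K, infinite_set [set n | k n = j].
Hypotheses (K1 : (1 < K)%N) (K4 : (K <= 4)%N).

Lemma infinite_index_ge (j : 'I_K) N : exists2 n, (N < n)%N & k n = j.
Proof.
apply: contrapT => no; apply: (hk (j := j)).
apply: (sub_finite_set _ (finite_II N.+1)) => n /= kn.
by rewrite ltnS leqNgt; apply/negP => Nn; apply: no; exists n.
Qed.

(** Take the least [q] such that all indices occur after [N] and up to [q], then the largest [p] for
    this [q]. By extremality [k q] does not occur earlier in the window and [k p.+1] not later.
    Inner letters thus avoid two indices, and at most two of the at most four remain. *)
Lemma exists_window N : exists p q a b, [/\ (N <= p)%N, (p < q)%N,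
  (forall i, (p.+1 < i < q)%N -> k i = a \/ k i = b) &
  forall j, exists2 n, (p < n <= q)%N & k n = j].
Proof.
pose seen p q := [forall j, has (fun n => k n == j) (iota p.+1 (q - p))].
have seenP p q : reflect (forall j, exists2 n, (p < n <= q)%N & k n = j) (seen p q).
  apply: (iffP forallP) => h j.
    have /hasP[n + /eqP kn] := h j; rewrite mem_iota addSn ltnS => /andP[pn nq].
    exists n => //; rewrite pn /=; move: nq; case: (leqP p q) => [pq|qp].
      by rewrite subnKC.
    by rewrite (eqP (ltnW qp : (q - p == 0)%N)) addn0 leqNgt pn.
  have [n /andP[pn nq] kn] := h j; apply/hasP; exists n; last exact/eqP.
  by rewrite mem_iota addSn ltnS pn subnKC// ltnW// (leq_trans pn).
have /choice[f hf] j : exists n, (N < n)%N /\ k n = j.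
  by have [n ? ?] := infinite_index_ge j N; exists n.
have exq : exists q, seen N q.
  exists (\max_j f j)%N; apply/seenP => j; have [Nf kf] := hf j.
  by exists (f j) => //; rewrite Nf leq_bigmax.
case: (ex_minnP exq) => q seenq qmin.
have bound p : (seen p q && (N <= p))%N -> (p <= q)%N.
  move=> /andP[/seenP h _]; have [n /andP[pn nq] _] := h (Ordinal (ltnW K1)).
  exact/ltnW/(leq_trans pn).
have exp : exists p, seen p q && (N <= p)%N by exists N; rewrite seenq leqnn.
case: (ex_maxnP exp bound) => p /andP[seenp Np] pmax.
have pq : (p < q)%N.
  have /seenP/(_ (Ordinal (ltnW K1)))[n /andP[pn nq] _] := seenp.
  exact: leq_trans nq.
have first_new n : (p.+1 < n <= q)%N -> k n != k p.+1.
  move=> /andP[pn nq]; apply/negP => /eqP knp.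
  have : seen p.+1 q && (N <= p.+1)%N.
    rewrite leqW// andbT; apply/seenP => j.
    have /seenP/(_ j)[m /andP[pm mq] km] := seenp.
    move: pm; rewrite leq_eqVlt => /orP[/eqP e|pm]; last by exists m; rewrite ?pm.
    by exists n; rewrite ?pn// knp e.
  by move/pmax; rewrite ltnn.
have last_new n : (p < n < q)%N -> k n != k q.
  move=> /andP[pn nq]; apply/negP => /eqP knq.
  have : seen N q.-1.
    apply/seenP => j.
    have /seenP/(_ j)[m /andP[Nm mq] km] := seenq.
    move: mq; rewrite leq_eqVlt => /orP[/eqP e|mq]; last first.
      by exists m; rewrite ?Nm//= -ltnS prednK// (leq_ltn_trans _ mq).
    exists n; last by rewrite knq -e.
    by rewrite (leq_ltn_trans Np pn) -ltnS prednK// (leq_ltn_trans _ nq).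
  by move/qmin; case: (q) pq => // q' _; rewrite ltnn.
pose A := finset (fun j => j \in [seq k i | i <- iota p.+2 (q - p.+2)]).
have memA (j : 'I_K) : j \in A -> exists2 i, (p.+1 < i < q)%N & j = k i.
  rewrite finset.inE => jl; have [p2q|qp] := ltnP p.+1 q; last first.
    by move: jl; rewrite (eqP (leqW qp : (q - p.+2 == 0)%N)).
  have [i il ->] := @mapP _ _ _ _ _ jl; exists i => //.
  by move: il; rewrite mem_iota subnKC.
have /(card_le2_pair (k 0%N))[a [b hab]] : (#|A| <= 2)%N.
  have [p2q|] := ltnP p.+1 q; last first.
    move=> qp; have e : (q - p.+2 = 0)%N by apply/eqP; rewrite subn_eq0 leqW.
    apply: (@leq_trans 0) => //; rewrite leqn0 cards_eq0 /A e.
    by apply/eqP/finset.setP => j; rewrite !finset.inE.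
  have : A \subset (~: [set k p.+1; k q])%SET.
    apply/fintype.subsetP => j /memA[i /andP[pi iq] ->].
    rewrite !finset.inE negb_or first_new ?last_new//.
      by rewrite iq andbT ltnW.
    by rewrite pi ltnW.
  move/subset_leq_card/leq_trans; apply.
  rewrite cardsCs finset.setCK cards2 card_ord eq_sym first_new ?p2q//=.
  by rewrite leq_subLR.
exists p, q, a, b; split=> //; last exact/seenP.
move=> i /andP[pi iq]; apply: hab; rewrite inE; apply: map_f.
by rewrite mem_iota pi subnKC ?iq// ltnW// (leq_ltn_trans pi iq).
Qed.

End Windows.

Section Convergence.
Context {R : realType} {s : scalar_kind} {H : hilbertType R s}.
Variables (K : nat) (L : 'I_K -> set H).
Hypothesis hL : forall k, closed_subspace (L k).
Hypotheses (K1 : (1 < K)%N) (K4 : (K <= 4)%N).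

(** The limit is 0. Norms decrease, and at the end of a window regularity bounds the norm by a
    multiple of the root of the loss; norms staying above some [e] would lose a fixed amount in
    infinitely many windows. *)
Lemma regular_iterates_cvg (M : 'I_K -> set H) (z0 : H) (k : nat -> 'I_K) :
    regular L ->
    (forall i, closed_subspace (M i)) -> (forall i, M i `<=` L i) ->
    (forall j : 'I_K, infinite_set [set n | k n = j]) ->
  cvgn (iterates M k z0).
Proof.
move=> /(regular_gt0)[c c0 hc] hM ML hk; pose z := iterates M k z0.
(* The factor 5 comes from [window_dist], applied once for each of the [K] subspaces. *)
pose C := c * (K%:R * 5) + 1.
have C0 : 0 < C by rewrite ltr_pwDr// !mulr_ge0// ltW.
have decrease N : exists2 q, (N < q)%N &
    nrm (z q) ^+ 2 <= C ^+ 2 * (nrm (z N) ^+ 2 - nrm (z q) ^+ 2).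
  have [p [q [a [b [Np pq ab all_in]]]]] := exists_window hk K1 K4 N.
  exists q; first exact: leq_ltn_trans pq.
  have zpN : nrm (z p) ^+ 2 <= nrm (z N) ^+ 2.
    by rewrite ler_pXn2r ?nnegrE ?nrm_ge0// (nrm_iterates_le hM).
  have zqp : nrm (z q) ^+ 2 <= nrm (z p) ^+ 2.
    by rewrite ler_pXn2r ?nnegrE ?nrm_ge0// (nrm_iterates_le hM)// ltnW.
  pose d := Num.sqrt (nrm (z p) ^+ 2 - nrm (z q) ^+ 2).
  have d2 : d ^+ 2 = nrm (z p) ^+ 2 - nrm (z q) ^+ 2 by rewrite sqr_sqrtr// subr_ge0.
  have d0 : 0 <= d by exact: sqrtr_ge0.
  have zq : nrm (z q) <= C * d.
    rewrite (le_trans (hc _))//.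
    have : \sum_j nrm (z q - proj (L j) (z q)) <= K%:R * (5 * d).
      apply: (@le_trans _ _ (\sum_(j < K) 5 * d)); last first.
        by rewrite sumr_const card_ord -[leLHS]mulr_natl.
      apply: ler_sum => j _; have [n pnq kn] := all_in j.
      have Lz : L j (z n).
        case: n pnq kn => // n pnq <-; apply: ML; exact: (iterates_in hM k z0 n).
      apply: le_trans (nrm_sub_proj_le (hL j) _ Lz) _.
      by apply: (window_dist hM d0 _ ab pnq); rewrite d2.
    by rewrite /C; nra.
  apply: (@le_trans _ _ (C ^+ 2 * d ^+ 2)).
    by rewrite -exprMn ler_pXn2r ?nnegrE ?nrm_ge0// mulr_ge0// ltW.
  by rewrite d2 ler_pM2l ?exprn_gt0// lerD2r.
have small e : 0 < e -> exists n, nrm (z n) < e.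
  move=> e0; apply: contrapT => no.
  have ge_e n : e <= nrm (z n) by rewrite leNgt; apply/negP => ?; apply: no; exists n.
  pose eta := e ^+ 2 / C ^+ 2.
  have eta0 : 0 < eta by rewrite divr_gt0 ?exprn_gt0.
  have drop m : exists q, nrm (z q) ^+ 2 <= nrm (z 0%N) ^+ 2 - m%:R * eta.
    elim: m => [|m [N hN]]; first by exists 0%N; rewrite mul0r subr0.
    have [q _ hq] := decrease N; exists q.
    have : e ^+ 2 <= nrm (z q) ^+ 2 by rewrite ler_pXn2r ?nnegrE ?nrm_ge0// ltW.
    move=> /le_trans/(_ hq); rewrite mulrC -ler_pdivrMr ?exprn_gt0// -/eta.
    by rewrite -natr1; lra.
  have [q] := drop (Num.truncn (nrm (z 0%N) ^+ 2 / eta)).+1.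
  have : nrm (z 0%N) ^+ 2 < (Num.truncn (nrm (z 0%N) ^+ 2 / eta)).+1%:R * eta.
    by rewrite -ltr_pdivrMr// truncnS_gt.
  by have := sqr_ge0 (nrm (z q)); lra.
apply/cvg_ex; exists 0; apply/cvgn_limit => e /small[N hN]; exists N => n Nn.
by rewrite subr0 (le_lt_trans _ hN)// (nrm_iterates_le hM).
Qed.

End Convergence.

(** * Elementary bounds and choice with history *)

Lemma finite_lower_bound (R : realType) (I : finType) (f : I -> R) :
  (forall i, 0 < f i) -> exists2 m, 0 < m & forall i, m <= f i.
Proof.
move=> f0; exists (\big[Num.min/1]_i f i).
  by elim/big_rec: _ => [|i x _ x0]; rewrite ?ltr01// lt_min f0.
by move=> i; rewrite (bigD1 i)//= ge_min lexx.
Qed.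

Lemma bernoulli_le (R : realType) (x : R) n :
  0 <= x -> x <= 1 -> 1 - n%:R * x <= (1 - x) ^+ n.
Proof.
move=> x0 x1; elim: n => [|n ih]; first by rewrite mul0r subr0.
rewrite exprSr -natr1; have := ler_wpM2r (_ : 0 <= 1 - x) ih; rewrite subr_ge0 => /(_ x1).
by have := @ler0n R n; have := sqr_ge0 x; nra.
Qed.

Lemma exists_common_power (R : realType) (e : R) (cs : seq R) : 0 < e ->
    (forall c, c \in cs -> 0 <= c /\ c < 1) ->
  exists t, forall c, c \in cs -> c ^+ t <= e.
Proof.
move=> e0; suff : (forall c, c \in cs -> 0 <= c /\ c < 1) ->
    exists N, forall n, (N <= n)%N -> forall c, c \in cs -> c ^+ n <= e.
  by move=> h /h[N hN]; exists N; exact: hN.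
elim: cs => [_|c cs ih hcs]; first by exists 0%N.
have [c0 c1] := hcs c (mem_head _ _).
have [N hN] := expr_small c0 c1 e0.
have [M hM] := ih (fun x xs => hcs x (mem_behead (s := c :: cs) xs)).
exists (maxn N M) => n; rewrite geq_max => /andP[Nn Mn] x.
by rewrite inE => /orP[/eqP ->|]; [exact/ltW/hN|exact: hM].
Qed.

(** Dependent choice where each term may depend on all earlier ones; [pre n] is the history chosen
    so far. *)
Lemma history_choice (T : Type) (P : seq T -> T -> Prop) :
  (forall l, exists x, P l x) -> exists x : nat -> T, forall n, P (mkseq x n) (x n).
Proof.
move=> /choice[f fP].
pose pre := fix pre n := if n is m.+1 then rcons (pre m) (f (pre m)) else [::].
exists (fun n => f (pre n)) => n.
suff -> : mkseq (fun n => f (pre n)) n = pre n by [].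
elim: n => //= n ih; rewrite /mkseq -addn1 iotaD map_cat -/(mkseq _ _) ih /=.
by rewrite cats1.
Qed.

(** * Tuples of nearly equal unit vectors *)

Section Selection.
Context {R : realType} {s : scalar_kind} {H : hilbertType R s}.
Implicit Types (x y z f : H) (e d : R).

Definition almost_common (K : nat) (L : 'I_K -> set H) := forall e, 0 < e ->
  exists2 x, nrm x = 1 & forall k, exists2 y, L k y & nrm (x - y) <= e.

Definition trivial_meet (K : nat) (L : 'I_K -> set H) :=
  forall x, (forall k, L k x) -> x = 0.

(** A vector violating the regularity inequality with constant [e^-1], divided by its norm, is a
    witness. *)
Lemma not_regular_almost_common (K : nat) (L : 'I_K -> set H) :
  (forall k, closed_subspace (L k)) -> ~ regular L -> almost_common L.
Proof.
move=> hL nreg e e0.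
have [x xe] : exists x, e^-1 * \sum_k nrm (x - proj (L k) x) < nrm x.
  apply: contrapT => no; apply: nreg; exists e^-1 => x; rewrite leNgt.
  by apply/negP => h; apply: no; exists x.
have x0 : 0 < nrm x.
  by apply: le_lt_trans xe; rewrite mulr_ge0 ?sum_dist_ge0// invr_ge0 ltW.
exists (of_real (nrm x)^-1 *: x).
  by rewrite nrmZr ger0_norm ?invr_ge0 ?nrm_ge0// mulVf ?gt_eqF.
move=> k; exists (of_real (nrm x)^-1 *: proj (L k) x).
  by case: (closed_subspace_submod (hL k)) => _ _; apply; exact: proj_in.
rewrite -scalerBr nrmZr ger0_norm ?invr_ge0 ?nrm_ge0// mulrC ler_pdivrMr//.
rewrite ltr_pdivrMl// in xe; apply: le_trans (ltW xe).
by rewrite (bigD1 k)//= lerDl; apply: sumr_ge0 => j _; exact: nrm_ge0.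
Qed.

Section Dense.
Variables (K : nat) (L : 'I_K -> set H).
Hypothesis hL : forall k, closed_subspace (L k).
Hypothesis L0 : trivial_meet L.

Lemma set_sum_submod (M : 'I_K -> set H) : (forall k, submod (M k)) -> submod (set_sum M).
Proof.
move=> sM; split.
- exists (fun=> 0); split=> [k|]; last by rewrite big1.
  by case: (sM k).
- move=> x y [v [vM ->]] [w [wM ->]]; exists (fun k => v k + w k).
  by split=> [k|]; [case: (sM k) => _ + _; exact|rewrite big_split].
- move=> a x [v [vM ->]]; exists (fun k => a *: v k).
  by split=> [k|]; [case: (sM k) => _ _; exact|rewrite scaler_sumr].
Qed.

(** A vector orthogonal to the sum lies in the double orthocomplement of every [L k], that is in
    every [L k], and vanishes by [L0]. *)
Lemma sum_orthocomp_dense f : closure (set_sum (fun k => orthocomp (L k))) f.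
Proof.
have sS : submod (set_sum (fun k => orthocomp (L k))).
  by apply: set_sum_submod => k; exact/closed_subspace_submod/orthocomp_closed_subspace.
have [y Sy oy] := ortho_decomposition f sS.
suff /eqP : f - y = 0 by rewrite subr_eq0 => /eqP ->.
apply: L0 => k; rewrite -(biorthocomp_id (hL k)) => z oz.
apply: oy; exists (fun j => if j == k then z else 0); split=> [j|].
  by case: eqP => [->//|_] w _; exact: inner0r.
by rewrite -big_mkcond big_pred1_eq.
Qed.

(** Weak convergence to 0 of nearly common vectors: [f] is nearly a sum of vectors [v k] orthogonal
    to [L k], and pairing [x] with [v k] sees only the small difference between [x] and [L k]. *)
Lemma almost_common_weak_null f e : 0 < e -> exists2 d, 0 < d & forall x, nrm x <= 1 ->
    (forall k, exists2 y, L k y & nrm (x - y) <= d) ->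
  modulus (inner x f) <= e.
Proof.
move=> e0; have e2 : 0 < e / 2 by rewrite divr_gt0.
have /closure_nrmP/(_ _ e2)[_ [v [vL ->]] vf] := @sum_orthocomp_dense f.
pose V := \sum_k nrm (v k).
have V0 : 0 <= V by apply: sumr_ge0 => k _; exact: nrm_ge0.
have V1 : 0 < V + 1 by rewrite ltr_pwDr.
exists ((e / 2) / (V + 1)); first by rewrite divr_gt0.
set d := _ / (V + 1) => x x1 hx.
have /choice[y yP] k : exists y, L k y /\ nrm (x - y) <= d.
  by have [y ? ?] := hx k; exists y.
have yL k := (yP k).1; have yd k := (yP k).2.
have -> : inner x f = inner x (f - \sum_k v k) + \sum_k inner (x - y k) (v k).
  have -> : \sum_k inner (x - y k) (v k) = inner x (\sum_k v k).
    rewrite inner_sumr; apply: eq_bigr => k _.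
    by rewrite innerBl (vL k _ (yL k)) subr0.
  by rewrite -innerDr subrK.
have modD (a b : scalars R s) : modulus (a + b) <= modulus a + modulus b.
  have := ler_normD a b; rewrite !normrE_modulus -(rmorphD of_real).
  by rewrite ler_of_real.
apply: le_trans (modD _ _) _.
have h1 : modulus (inner x (f - \sum_k v k)) <= e / 2.
  apply: le_trans (cauchy_schwarz _ _) _.
  have := nrm_ge0 (f - \sum_k v k); have := nrm_ge0 x.
  by move: vf; rewrite nrm_distC; nra.
have h2 : modulus (\sum_k inner (x - y k) (v k)) <= d * V.
  rewrite /V mulr_sumr; elim/big_rec2: _ => [|k a b _ h].
    by rewrite /modulus normr0 raddf0.
  apply: le_trans (modD _ _) _; rewrite lerD//.
  apply: le_trans (cauchy_schwarz _ _) _; rewrite ler_wpM2r ?nrm_ge0//.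
have : d * (V + 1) = e / 2 by rewrite /d divfK// gt_eqF.
have d0 : 0 < d by rewrite divr_gt0.
by nra.
Qed.

End Dense.

Lemma closed_subspaceI (A B : set H) :
  closed_subspace A -> closed_subspace B -> closed_subspace (A `&` B).
Proof.
move=> [/submodP[A0 AD AZ] cA] [/submodP[B0 BD BZ] cB]; split; last exact: closedI.
apply/submodP; split=> //.
- by move=> x y [Ax Bx] [Ay By]; split; [exact: AD|exact: BD].
- by move=> a x [Ax Bx]; split; [exact: AZ|exact: BZ].
Qed.

(** For [y] in [L k] the product with [f] equals the product with the projection [g k] of [f]. It is
    small by weak convergence, so removing the component of [y] along [g k] costs little and makes
    [y] orthogonal to [f]. *)
Lemma almost_common_orthogonal (K : nat) (L : 'I_K -> set H) f :
    (forall k, closed_subspace (L k)) -> trivial_meet L ->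
  almost_common L -> almost_common (fun k => L k `&` orthocomp [set f]).
Proof.
move=> hL L0 acL e e0.
pose g k := proj (L k) f.
(* Removing the component divides by the length of [g k], so the nonzero [g k] have to be bounded
   away from 0. Where [g k = 0], no correction is made. *)
have [m m0 hm] : exists2 m : R, 0 < m & forall k, g k != 0 -> m <= nrm (g k).
  have [k|m m0 hm] := @finite_lower_bound R _ (fun k => if g k == 0 then 1 else nrm (g k)).
    by case: eqP => // /eqP; rewrite nrm_gt0.
  by exists m => // k /negbTE gk; have := hm k; rewrite gk.
have em : 0 < e * m / 4 by rewrite divr_gt0 ?mulr_gt0.
have [d d0 hd] := almost_common_weak_null hL L0 f em.
pose d' := Num.min d (Num.min (e / 2) ((e * m / 4) / (nrm f + 1))).
have f1 : 0 < nrm f + 1 by rewrite ltr_pwDr ?nrm_ge0.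
have d'0 : 0 < d' by rewrite !lt_min d0 !divr_gt0// mulr_gt0.
have d'd : d' <= d by rewrite ge_min lexx.
have d'e : d' <= e / 2 by rewrite !ge_min lexx !orbT.
have d'f : d' * (nrm f + 1) <= e * m / 4 by rewrite -ler_pdivlMr// !ge_min lexx !orbT.
have [x x1 hx] := acL d' d'0; exists x => // k.
have [y Ly xy] := hx k.
have xf : modulus (inner x f) <= e * m / 4.
  by apply: hd => [|j]; [rewrite x1|have [z Lz xz] := hx j; exists z => //; exact: le_trans xz d'd].
have yf : modulus (inner y f) <= e * m / 2.
  have -> : inner y f = inner x f - inner (x - y) f by rewrite innerBl opprB addrC subrK.
  have : modulus (inner x f - inner (x - y) f) <=
      modulus (inner x f) + modulus (inner (x - y) f).
    have := ler_normB (inner x f) (inner (x - y) f).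
    by rewrite !normrE_modulus -(rmorphD of_real) ler_of_real.
  have := cauchy_schwarz (x - y) f; have := nrm_ge0 f; have := nrm_ge0 (x - y).
  nra.
have fg z : L k z -> inner z f = inner z (g k) by move=> Lz; rewrite inner_proj_in.
have [g0|g0] := eqVneq (g k) 0.
  exists y; last by rewrite (le_trans xy)// (le_trans d'e)//; lra.
  by split=> // _ ->; apply: inner_eq0C; rewrite fg// g0 inner0r.
have gp : 0 < nrm (g k) by rewrite nrm_gt0.
have Lg : L k (g k) by exact: proj_in.
have sL := closed_subspace_submod (hL k).
pose c := of_real (nrm (g k) ^- 2) * inner y (g k).
have Ly' : L k (y - c *: g k).
  by apply: submodB => //; case: sL => _ _; exact.
exists (y - c *: g k); first split=> // _ ->.
  apply: inner_eq0C; rewrite fg// innerBl innerZl inner_self /c mulrAC -rmorphM.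
  by rewrite mulVf ?rmorph1 ?mul1r ?subrr// expf_neq0// gt_eqF.
rewrite (le_trans (nrm_triangle y _ _))// subKr nrmZ modulusM modulus_real.
rewrite ger0_norm ?invr_ge0 ?exprn_ge0 ?nrm_ge0//.
have -> : nrm (g k) ^- 2 * modulus (inner y (g k)) * nrm (g k) =
    modulus (inner y (g k)) / nrm (g k) by field; rewrite gt_eqF.
have : modulus (inner y (g k)) / nrm (g k) <= e / 2.
  rewrite ler_pdivrMr// -fg//; have := hm k g0; nra.
lra.
Qed.

Lemma almost_common_orthogonal_seq (K : nat) (L : 'I_K -> set H) (F : seq H) :
    (forall k, closed_subspace (L k)) -> trivial_meet L -> almost_common L ->
  almost_common (fun k => [set x | L k x /\ forall f, f \in F -> inner f x = 0]).
Proof.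
elim: F L => [|f F ih] L hL L0 acL e e0.
  by have [x x1 hx] := acL e e0; exists x => // k; have [y Ly xy] := hx k; exists y.
have [|||x x1 hx] := ih (fun k => L k `&` orthocomp [set f]) _ _ _ e e0.
- by move=> k; apply: closed_subspaceI => //; exact: orthocomp_closed_subspace.
- by move=> x hx; apply: L0 => k; have [] := hx k.
- exact: almost_common_orthogonal.
exists x => // k; have [y [[Ly fy] Fy] xy] := hx k; exists y => //; split=> // h.
by rewrite inE => /orP[/eqP ->|/Fy//]; exact: fy.
Qed.

End Selection.

(** * Orthogonal sequences of unit tuples *)

Section Sequences.
Context {R : realType} {s : scalar_kind} {H : hilbertType R s}.
Variables (K : nat) (L : 'I_K -> set H).
Hypothesis hL : forall k, closed_subspace (L k).
Hypothesis L0 : trivial_meet L.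
Hypothesis acL : almost_common L.
Implicit Types (u : 'I_K -> H) (e : R).

Definition unit_tuple (F : seq H) e u :=
  [/\ forall k, L k (u k), forall k, nrm (u k) = 1,
      forall k f, f \in F -> inner f (u k) = 0 &
      forall k k', nrm (u k - u k') <= e].

Lemma nrm_normalize (y : H) : y != 0 -> nrm (of_real (nrm y)^-1 *: y) = 1.
Proof.
move=> y0; rewrite nrmZr ger0_norm ?invr_ge0 ?nrm_ge0// mulVf//.
by rewrite nrm_eq0.
Qed.

(** A vector within [d <= 2^-1] of a unit vector is nonzero, and normalizing moves it by at most
    another [d]; two normalized vectors then differ by at most [4 * d]. *)
Lemma exists_unit_tuple (F : seq H) e : 0 < e -> exists u, unit_tuple F e u.
Proof.
move=> e0; pose d := Num.min 2^-1 (e / 4).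
have d0 : 0 < d by rewrite lt_min invr_gt0 divr_gt0// ltr0n.
have d2 : d <= 2^-1 by rewrite ge_min lexx.
have d4 : d <= e / 4 by rewrite ge_min lexx orbT.
have [x x1 hx] := almost_common_orthogonal_seq F hL L0 acL d0.
have /choice[y yP] k : exists y, (L k y /\ forall f, f \in F -> inner f y = 0) /\ nrm (x - y) <= d.
  by have [y] := hx k; exists y.
have yx k : nrm (x - y k) <= d by case: (yP k).
have y_near1 k : `|1 - nrm (y k)| <= d.
  have := ler_dist_nrm x (y k); have := ler_dist_nrm (y k) x.
  by rewrite nrm_distC x1 ler_norml; have := yx k; lra.
have y0 k : y k != 0.
  apply/eqP => yk; have := y_near1 k; rewrite yk nrm0 subr0 normr1; lra.
pose u k := of_real (nrm (y k))^-1 *: y k.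
have ux k : nrm (u k - x) <= 2 * d.
  apply: le_trans (nrm_triangle (y k) _ _) _; rewrite mulr_natl mulr2n lerD//; last first.
    by rewrite nrm_distC.
  rewrite -[X in _ - X]scale1r -(rmorph1 of_real) -scalerBl -rmorphB nrmZr.
  rewrite -{2}(ger0_norm (nrm_ge0 (y k))) -normrM mulrBl mulVf ?nrm_eq0//.
  by rewrite mul1r.
exists u; split=> [k|k|k f fF|k k'].
- by case: (closed_subspace_submod (hL k)) => _ _; apply; case: (yP k) => -[].
- exact: nrm_normalize.
- by rewrite innerZr; case: (yP k) => -[_ ->]//; rewrite mulr0.
- have := nrm_triangle x (u k) (u k'); have := ux k; have := ux k'.
  by rewrite (nrm_distC x); lra.
Qed.

(** For unit vectors this is the squared cosine of their angle: the factor lost by projecting from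
    one line to the other and back. *)
Definition overlap u (i j : 'I_K) : R := modulus (inner (u i) (u j)) ^+ 2.

Lemma overlap_ge0 u i j : 0 <= overlap u i j.
Proof. exact: sqr_ge0. Qed.

Lemma overlap_le1 u i j : (forall k, nrm (u k) = 1) -> overlap u i j <= 1.
Proof.
move=> u1; rewrite -(expr1n _ 2) ler_pXn2r ?nnegrE ?modulus_ge0//.
by have := cauchy_schwarz (u i) (u j); rewrite !u1 mulr1.
Qed.

Lemma overlap_near1 u i j e : (forall k, nrm (u k) = 1) ->
  nrm (u i - u j) <= e -> 0 <= e -> e <= 1 -> 1 - e <= overlap u i j.
Proof.
move=> u1 uij e0 e1; have := sqr_nrmB (u i) (u j); rewrite !u1 => h.
have := scalar_re_le_modulus (inner (u i) (u j)); rewrite -/(rdot _ _) => re_le.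
have : nrm (u i - u j) ^+ 2 <= e ^+ 2 by rewrite ler_pXn2r ?nnegrE ?nrm_ge0.
rewrite h expr1n => h'.
have e2 : e ^+ 2 <= e by rewrite expr2 ler_piMr.
have m_ge : 1 - e / 2 <= modulus (inner (u i) (u j)) by lra.
rewrite /overlap (@le_trans _ _ ((1 - e / 2) ^+ 2))//; first by nra.
by rewrite ler_pXn2r ?nnegrE ?modulus_ge0//; lra.
Qed.

(** Otherwise every pair has overlap 1 under suitable constraints [F], [e]. Imposing all of them at
    once yields pairwise parallel unit vectors, which lie in all [L k], against [L0]. The pair
    precedes [F] and [e] because one pair has to serve the whole sequence. *)
Lemma exists_separated_pair : (0 < K)%N -> exists i j, forall F e, 0 < e ->
  exists2 u, unit_tuple F e u & overlap u i j < 1.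
Proof.
move=> K0; apply: contrapT => no.
have /choice[Fe FeP] (p : 'I_K * 'I_K) : exists Fe : seq H * R, 0 < Fe.2 /\
    forall u, unit_tuple Fe.1 Fe.2 u -> overlap u p.1 p.2 = 1.
  apply: contrapT => no'; apply: no; exists p.1, p.2 => F e e0.
  apply: contrapT => no''; apply: no'; exists (F, e); split=> // u uP.
  have [_ u1 _ _] := uP.
  apply/eqP; rewrite eq_le overlap_le1// leNgt; apply/negP => ult.
  by apply: no''; exists u.
have [p|e e0 he] := @finite_lower_bound R _ (fun p => (Fe p).2).
  by have [] := FeP p.
have [u uP] := exists_unit_tuple (flatten [seq (Fe p).1 | p : 'I_K * 'I_K]) e0.
have [uL u1 uF ue] := uP.
have u_all i j : overlap u i j = 1.
  have [_ h] := FeP (i, j); apply: h; split=> // [k f fF|k k'].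
    by apply: uF; apply/flattenP; exists (Fe (i, j)).1 => //; apply/fintype.imageP; exists (i, j).
  by rewrite (le_trans (ue k k')).
pose i0 := Ordinal K0.
suff : u i0 = 0 by move=> /(congr1 nrm)/eqP; rewrite u1 nrm0 oner_eq0.
apply: L0 => j.
have uj0 : u j != 0 by rewrite -nrm_gt0 u1.
have := sqr_nrm_sub_line (u i0) uj0; rewrite !u1 -/(overlap u i0 j) u_all.
rewrite expr1n divr1 subrr => /eqP; rewrite sqrf_eq0 nrm_eq0 subr_eq0 => /eqP ->.
by case: (closed_subspace_submod (hL j)) => _ _; exact.
Qed.

(* Raising the overlaps to the power [t q] separates the tuples up to [q], which
   are killed, from the later ones, which are still unaffected. *)
Record spread (tau : nat -> R) (i j : 'I_K) (u : nat -> 'I_K -> H)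
    (t : nat -> nat) : Prop := Spread {
  spread_in : forall a k, L k (u a k);
  spread_unit : forall a k, nrm (u a k) = 1;
  spread_ortho : forall a b k k', a != b -> inner (u a k) (u b k') = 0;
  spread_near : forall a k k', nrm (u a k - u a k') <= tau a;
  spread_overlap : forall a k k', 1 - tau a <= overlap (u a) k k';
  spread_killed : forall a q, (a <= q)%N -> overlap (u a) i j ^+ t q <= tau q;
  spread_alive : forall a q, (q < a)%N -> 1 - tau q <= overlap (u a) i j ^+ t q
}.

(** Recursive choice: first a tuple orthogonal to the earlier ones and so nearly constant that the
    earlier powers barely affect it, then a power that kills it and all earlier tuples. *)
Lemma exists_spread (tau : nat -> R) : (0 < K)%N -> (forall a, 0 < tau a) ->
  exists i j (u : nat -> 'I_K -> H) t, i <> j /\ spread tau i j u t.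
Proof.
move=> K0 tau0; have [i [j ij]] := exists_separated_pair K0.
pose c (p : ('I_K -> H) * nat) := overlap p.1 i j.
(* The history [l] is an arbitrary list here, so the clause killing earlier tuples assumes their
   overlap below 1; along the chosen sequence this always holds. *)
pose good (l : seq (('I_K -> H) * nat)) p := [/\
  (forall k, L k (p.1 k)) /\ (forall k, nrm (p.1 k) = 1),
  forall q, (q < size l)%N -> forall k k', inner ((nth p l q).1 k) (p.1 k') = 0,
  (forall k k', nrm (p.1 k - p.1 k') <= tau (size l)) /\
    (forall k k', 1 - tau (size l) <= overlap p.1 k k'),
  c p < 1 /\ (forall q, (q < size l)%N -> 1 - tau q <= c p ^+ (nth p l q).2) &
  (forall q, (q < size l)%N -> c (nth p l q) < 1 -> c (nth p l q) ^+ p.2 <= tau (size l))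
    /\ c p ^+ p.2 <= tau (size l)].
have [p goodp] : exists p, forall n, good (mkseq p n) (p n).
  apply: history_choice => l.
  have [[x0 _]|] := pselect (exists x0 : ('I_K -> H) * nat, True); last first.
    by move=> h; exfalso; apply: h; exists (fun=> 0, 0%N).
  (* By Bernoulli's inequality an overlap of at least [1 - e] with [e <= m] stays above [1 - tau q]
     when raised to the earlier powers. *)
  have [q|m m0 hm] := @finite_lower_bound R _
      (fun q : 'I_(size l) => tau q / ((nth x0 l q).2.+1)%:R).
    by rewrite divr_gt0.
  pose e := Num.min 1 (Num.min m (tau (size l))).
  have e0 : 0 < e by rewrite !lt_min ltr01 m0 tau0.
  have e1 : e <= 1 by rewrite ge_min lexx.
  have em : e <= m by rewrite !ge_min lexx orbT.
  have etau : e <= tau (size l) by rewrite !ge_min lexx !orbT.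
  have [u [uL u1 uF ue] uij] := ij (flatten [seq [seq p.1 k | k : 'I_K] | p <- l]) e e0.
  have cs01 x : x \in overlap u i j :: [seq c p | p <- l & c p < 1] -> 0 <= x /\ x < 1.
    rewrite inE => /orP[/eqP ->|/mapP[p]]; first by rewrite overlap_ge0.
    by rewrite mem_filter => /andP[cp1 _] ->; rewrite overlap_ge0.
  have [t tP] := exists_common_power (tau0 (size l)) cs01.
  have nth_l q : (q < size l)%N -> nth (u, t) l q = nth x0 l q.
    by move=> ql; apply: set_nth_default.
  exists (u, t); split=> //=.
  - move=> q ql k k'; apply: uF; apply/flattenP.
    exists [seq (nth (u, t) l q).1 k | k : 'I_K]; last by apply/fintype.imageP; exists k.
    by apply/mapP; exists (nth (u, t) l q) => //; exact: mem_nth.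
  - split=> k k'; first exact: le_trans (ue _ _) etau.
    by apply: le_trans (overlap_near1 u1 (ue k k') (ltW e0) e1); rewrite lerD2l lerN2.
  - split=> // q ql; rewrite nth_l// /c /=.
    set n := (nth x0 l q).2.
    have cn : 1 - e <= overlap u i j by exact: overlap_near1 (ltW e0) e1.
    apply: (@le_trans _ _ ((1 - e) ^+ n)); last first.
      by rewrite lerXn2r ?nnegrE ?overlap_ge0// subr_ge0.
    apply: le_trans (bernoulli_le n (ltW e0) e1); rewrite lerD2l lerN2.
    have := hm (Ordinal ql); rewrite /= -/n ler_pdivlMr// => hm'.
    have : n%:R * e <= n.+1%:R * m by rewrite ler_pM ?(ltW e0)// ler_nat.
    by move/le_trans; apply; rewrite mulrC.
  - split=> [q ql cq|]; last by apply: tP; rewrite mem_head.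
    by apply: tP; rewrite inE map_f ?orbT// mem_filter cq mem_nth.
have nth_p n q (d : ('I_K -> H) * nat) : (q < n)%N -> nth d (mkseq p n) q = p q.
  by move=> qn; rewrite nth_mkseq.
have sz n : size (mkseq p n) = n by rewrite size_mkseq.
have ortho_lt a b k k' : (a < b)%N -> inner ((p a).1 k) ((p b).1 k') = 0.
  move=> ab; have [_ h _ _ _] := goodp b.
  by have := h a; rewrite sz nth_p// => /(_ ab k k').
have i_neq_j : i <> j.
  move=> e; have [[_ u1] _ _ [+ _] _] := goodp 0%N.
  by rewrite /c e /overlap inner_self u1 expr1n modulus_real normr1 expr1n ltxx.
exists i, j, (fun a => (p a).1), (fun q => (p q).2); split=> //; split.
- by move=> a k; have [[h _] _ _ _ _] := goodp a.
- by move=> a k; have [[_ h] _ _ _ _] := goodp a.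
- move=> a b k k'; rewrite neq_ltn => /orP[ab|ba]; first exact: ortho_lt.
  exact/inner_eq0C/ortho_lt.
- by move=> a k k'; have [_ _ [+ _] _ _] := goodp a; rewrite sz.
- by move=> a k k'; have [_ _ [_ +] _ _] := goodp a; rewrite sz.
- move=> a q; rewrite leq_eqVlt => /orP[/eqP ->|aq].
    by have [_ _ _ _ [_ +]] := goodp q; rewrite sz.
  have [_ _ _ _ [+ _]] := goodp q; rewrite sz => /(_ a aq); rewrite nth_p//; apply.
  by have [_ _ _ [+ _] _] := goodp a.
- move=> a q qa; have [_ _ _ [_ +] _] := goodp a; rewrite sz => /(_ q qa).
  by rewrite nth_p.
Qed.

(* If the sum were the whole space, pairing [\sum_a 2^-a u_a], where the [u_a]
   are orthonormal and within [4^-a] of every [L k], with [u_a] would give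
   [2^-a <= C 4^-a]. *)
Lemma sum_orthocomp_not_setT : (0 < K)%N ->
  set_sum (fun k => orthocomp (L k)) <> setT.
Proof.
move=> K0 full.
have tau0 a : 0 < (4^-1 : R) ^+ a by rewrite exprn_gt0// invr_gt0.
have [i [j [u [t [_ uP]]]]] := exists_spread K0 tau0.
pose S n : H := \sum_(a < n) of_real (2^-1 ^+ a) *: u a i.
have [y Sy] : exists y, limit S y.
  apply: (@geometric_limit _ _ _ S 1 2^-1); rewrite ?invr_ge0 ?invf_lt1 ?ltr1n// => n.
  rewrite /S big_ord_recr /= addrC addrK nrmZr (spread_unit uP) mulr1 mul1r.
  by rewrite ger0_norm// exprn_ge0// invr_ge0.
have [v [vL yv]] : set_sum (fun k => orthocomp (L k)) y by rewrite full.
have uy a : inner (u a i) y = of_real (2^-1 ^+ a).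
  apply/eqP; rewrite -subr_eq0 -modulus_eq0 eq_le modulus_ge0 andbT.
  apply/ler_addgt0Pr => e /Sy[N hN]; rewrite add0r.
  pose n := maxn N a.+1.
  have uS : inner (u a i) (S n) = of_real (2^-1 ^+ a).
    have an : (a < n)%N by rewrite leq_maxr.
    rewrite inner_sumr (bigD1 (Ordinal an))//= innerZr scalar_conj_real.
    rewrite inner_self (spread_unit uP) expr1n rmorph1 mulr1 big1 ?addr0// => b ba.
    rewrite innerZr (spread_ortho uP) ?mulr0//.
    by rewrite eq_sym; apply: contra ba => /eqP ba; apply/eqP/val_inj.
  rewrite -uS -innerBr (le_trans (cauchy_schwarz _ _))// (spread_unit uP) mul1r.
  by rewrite nrm_distC ltW// hN// leq_maxl.
pose V := \sum_k nrm (v k).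
have V0 : 0 <= V by apply: sumr_ge0 => k _; exact: nrm_ge0.
have bound a : (2^-1 : R) ^+ a <= 4^-1 ^+ a * V.
  rewrite -[leLHS](@of_realK R s) (_ : of_real _ = inner (u a i) y)// yv inner_sumr raddf_sum mulr_sumr.
  apply: ler_sum => k _; apply: le_trans (scalar_re_le_modulus _) _.
  have -> : inner (u a i) (v k) = inner (u a i - u a k) (v k).
    by rewrite innerBl (vL k _ (spread_in uP a k)) subr0.
  apply: le_trans (cauchy_schwarz _ _) _.
  by rewrite ler_wpM2r ?nrm_ge0// (spread_near uP).
have e0 : 0 < (V + 1)^-1 by rewrite invr_gt0 ltr_pwDr.
have [||N /(_ N (leqnn N)) hN] := @expr_small R 2^-1 _ _ _ e0.
- by rewrite invr_ge0.
- by rewrite invf_lt1// ltr1n.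
have := bound N; have -> : (4^-1 : R) ^+ N = 2^-1 ^+ N * 2^-1 ^+ N.
  by rewrite -exprMn -invfM -natrM.
move: hN; rewrite -[(V + 1)^-1]mul1r ltr_pdivlMr; last by rewrite ltr_pwDr.
have : 0 < (2^-1 : R) ^+ N by rewrite exprn_gt0 ?invr_gt0.
nra.
Qed.

End Sequences.

(** * Fine angles and killing rates *)

Lemma sin_le_id (R : realType) (x : R) : 0 <= x -> sin x <= x.
Proof.
rewrite le_eqVlt => /orP[/eqP <-|x0]; first by rewrite sin0.
have [c _] := @MVT R sin cos 0 x x0 (fun y _ => is_derive_sin y)
  (continuous_subspaceT (fun y => @continuous_sin R y)).
rewrite sin0 !subr0 => ->.
by rewrite ler_piMl ?cos_le1// ltW.
Qed.

(** Since [cos x] is at least its square, the loss [1 - cos x ^+ k] is at most [k * sin x ^+ 2],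
    which is of order [1 / k]. *)
Lemma exists_fine_angle (R : realType) (e : R) : 0 < e ->
  exists2 k : nat, (0 < k)%N & 1 - e <= cos (pi / 2 / k%:R : R) ^+ k.
Proof.
(* As [x * k <= 2], the loss is at most [4 / k], hence at most [e]. *)
move=> e0; pose k := (Num.truncn (4 / e)).+1; exists k => //.
have k0 : 0 < k%:R :> R by rewrite ltr0n.
have ke : 4 <= e * k%:R by rewrite -ler_pdivrMl// mulrC ltW// truncnS_gt.
set x := pi / 2 / k%:R.
have x0 : 0 <= x by rewrite !divr_ge0 ?pi_ge0// ltW.
have x2 : x * k%:R <= 2.
  by rewrite divfK ?gt_eqF// ltW// pihalf_lt2.
have xpi : x <= pi / 2.
  by rewrite ler_pdivrMr// ler_peMr ?divr_ge0 ?pi_ge0// ler1n.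
have c0 : 0 <= cos x.
  by apply: cos_ge0_pihalf; rewrite xpi andbT (le_trans _ x0)// oppr_le0 divr_ge0// pi_ge0.
have sx : 0 <= sin x.
  apply: sin_ge0_pi; rewrite x0 (le_trans xpi)// ler_pdivrMr//.
  by rewrite ler_peMr ?pi_ge0// ler1n.
have s1 : sin x ^+ 2 <= 1 by rewrite expr_le1// sin_le1.
have c2 : 1 - sin x ^+ 2 <= cos x.
  by have := cos2Dsin2 x; have := cos_le1 x; nra.
apply: le_trans (_ : (1 - sin x ^+ 2) ^+ k <= _); last first.
  by rewrite lerXn2r ?nnegrE// subr_ge0.
apply: le_trans (bernoulli_le k (sqr_ge0 _) s1); rewrite lerD2l lerN2.
have sle := sin_le_id x0.
have : k%:R * sin x ^+ 2 <= k%:R * x ^+ 2.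
  by rewrite ler_pM2l// ler_pXn2r ?nnegrE.
have : k%:R * x ^+ 2 * k%:R <= 4.
  rewrite (_ : _ * _ = (x * k%:R) ^+ 2); last by ring.
  by have := mulr_ge0 x0 (ltW k0); move: x2; move: (x * _) => y; nra.
move=> h1 h2; apply: le_trans h2 _.
by rewrite -(ler_pM2r k0) (le_trans h1).
Qed.

(** The last index comes first: choose the largest rate [top], then a power [M] that kills it, then
    a budget for the smaller rates and for [e] so tiny that [M] applications do not feel them. *)
Lemma exists_stage_scales (R : realType) (k : nat) (b kappa : R) :
    0 < b -> 0 < kappa ->
  exists (beta : nat -> R) (m : nat -> nat) (e : R),
    [/\ 0 < e, forall i, 0 < beta i /\ beta i <= 1, \sum_(i < k) beta i <= b &
      forall j, (j < k)%N ->
        (m j)%:R * 8 * (e + \sum_(i < j) beta i) + 2 * (1 - beta j) ^+ m j <= kappa].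
Proof.
move=> + kappa0; elim: k b => [|k ih] b b0.
  exists (fun=> 1), (fun=> 0%N), 1; split=> //; rewrite big_ord0; exact: ltW.
pose top := Num.min (b / 2) 1.
have top0 : 0 < top by rewrite lt_min divr_gt0// ltr01.
have top1 : top <= 1 by rewrite ge_min lexx orbT.
have topb : top <= b / 2 by rewrite ge_min lexx.
have k4 : 0 < kappa / 4 by rewrite divr_gt0.
have t0 : 0 <= 1 - top by rewrite subr_ge0.
have t1 : 1 - top < 1 by rewrite gtrBl.
have [M /(_ M (leqnn M)) hM] := expr_small t0 t1 k4.
(* The error and the smaller rates add up to at most [2 * c], and [M * 8 * (2 * c) <= kappa / 2];
   the remainder of the killed part takes the other half. *)
pose c := kappa / 32 / M.+1%:R.
have c0 : 0 < c by rewrite !divr_gt0.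
have [] := ih (Num.min (b / 2) c); first by rewrite lt_min divr_gt0// c0.
move=> beta [m [e [e0 beta01 sumb hm]]].
have sum_ext n : (n <= k)%N ->
    \sum_(i < n) (if (i < k)%N then beta i else top) = \sum_(i < n) beta i.
  by move=> nk; apply: eq_bigr => i _; rewrite (leq_trans (ltn_ord i) nk).
exists (fun i => if (i < k)%N then beta i else top),
  (fun i => if (i < k)%N then m i else M), (Num.min e c); split.
- by rewrite lt_min e0.
- by move=> i; case: ifP.
- rewrite big_ord_recr /= ltnn sum_ext//.
  have : Num.min (b / 2) c <= b / 2 by rewrite ge_min lexx.
  lra.
- move=> j; rewrite ltnS leq_eqVlt => /orP[/eqP ->|jk]; last first.
    rewrite jk sum_ext ?(ltnW jk)//; apply: le_trans (hm j jk).
    rewrite lerD2r ler_wpM2l ?mulr_ge0// lerD2r.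
    by rewrite ge_min lexx.
  rewrite ltnn sum_ext//.
  have h1 : Num.min e c + \sum_(i < k) beta i <= 2 * c.
    have : Num.min e c <= c by rewrite ge_min lexx orbT.
    have : Num.min (b / 2) c <= c by rewrite ge_min lexx orbT.
    lra.
  have h2 : M%:R * 8 * (2 * c) <= kappa / 2.
    rewrite /c (_ : _ * _ = kappa / 2 * (M%:R / M.+1%:R)); last first.
      have : (M.+1%:R : R) != 0 by rewrite pnatr_eq0.
      by move: (M.+1%:R : R) => N N0; field.
    rewrite ler_piMr ?divr_ge0 ?(ltW kappa0)//.
    by rewrite ler_pdivrMr// mul1r ler_nat.
  have : M%:R * 8 * (Num.min e c + \sum_(i < k) beta i) <= M%:R * 8 * (2 * c).
    by rewrite ler_wpM2l// mulr_ge0.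
  lra.
Qed.

(** * Turning a vector in a plane *)

Section Rotation.
Context {R : realType} {s : scalar_kind} {H : hilbertType R s}.
Implicit Types (x y z : H) (B : H -> H).

Record linear_contraction B : Prop := LinearContraction {
  contraction_add : forall x y, B (x + y) = B x + B y;
  contraction_scale : forall (a : scalars R s) x, B (a *: x) = a *: B x;
  contraction_le : forall x, nrm (B x) <= nrm x
}.

Lemma contraction_sub B x y : linear_contraction B -> B (x - y) = B x - B y.
Proof.
by move=> [BD BZ _]; rewrite BD -scaleN1r BZ scaleN1r.
Qed.

Lemma iter_linear_contraction B n : linear_contraction B -> linear_contraction (iter n B).
Proof.
move=> hB; elim: n => [|n [ihD ihZ ihle]]; first by split.
split=> [x y|a x|x] /=.
- by rewrite ihD (contraction_add hB).
- by rewrite ihZ (contraction_scale hB).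
- exact/(le_trans (contraction_le hB _))/ihle.
Qed.

Fixpoint run (B : nat -> H -> H) (m : nat -> nat) n x : H :=
  if n is j.+1 then iter (m j) (B j) (run B m j x) else x.

Variables (p q : H).
Hypotheses (p1 : nrm p <= 1) (q1 : nrm q <= 1).

Definition plane (a b : R) : H := of_real a *: p + of_real b *: q.

Lemma planeZ r a b : of_real r *: plane a b = plane (r * a) (r * b).
Proof. by rewrite /plane scalerDr !scalerA -!rmorphM. Qed.

Lemma planeB a b c d : plane a b - plane c d = plane (a - c) (b - d).
Proof. by rewrite /plane !rmorphB !scalerBl opprD addrACA. Qed.

Lemma nrm_plane a b : nrm (plane a b) <= `|a| + `|b|.
Proof.
rewrite (le_trans (ler_nrmD _ _))// !nrmZr lerD// ler_piMr//.
Qed.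

Variables (k : nat) (B : nat -> H -> H) (m : nat -> nat).
Variables (beta : nat -> R) (e kappa : R).
Hypothesis k0 : (0 < k)%N.
Hypothesis hB : forall j, linear_contraction (B j).
Hypothesis beta01 : forall i, 0 < beta i /\ beta i <= 1.
Hypothesis scales : forall j, (j < k)%N ->
  (m j)%:R * 8 * (e + \sum_(i < j) beta i) + 2 * (1 - beta j) ^+ m j <= kappa.
Hypothesis e0 : 0 <= e.

Let theta : R := pi / 2 / k%:R.
(** The index is shifted: step [i] starts at [i] times the angle [pi / 2 / k] and ends at [i.+1]
    times it. *)
Definition step_cos i : R := cos (i.+1%:R * (pi / 2 / k%:R)).
Definition step_sin i : R := sin (i.+1%:R * (pi / 2 / k%:R)).

(* The direction killed at step [i]; [plane (step_cos i) (step_sin i)] is the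
   orthogonal direction in the plane, onto which step [i] projects. *)
Definition kill_dir i := plane (step_sin i) (- step_cos i).

Hypothesis Bp : forall j, (j < k)%N -> nrm (B j p -
  (p - \sum_(i < j.+1) of_real (beta i * step_sin i) *: kill_dir i)) <= e.
Hypothesis Bq : forall j, (j < k)%N -> nrm (B j q -
  (q - \sum_(i < j.+1) of_real (beta i * - step_cos i) *: kill_dir i)) <= e.

Let h j := plane (cos (j%:R * theta)) (sin (j%:R * theta)).

(** The vector [h j] is [cos theta] times [h j.+1] plus [sin theta] times [kill_dir j]. Ideally each
    application of [B j] keeps the first part and multiplies the second by [1 - beta j]; the smaller
    rates and [e] are errors that add up over [m j] applications. *)
Lemma rotation_step j : (j < k)%N ->
  nrm (iter (m j) (B j) (h j) - of_real (cos theta) *: h j.+1) <= kappa.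
Proof.
move=> jk.
(* The ideal orbit of [h j] after [n] applications. *)
pose y n := plane (cos theta * step_cos j + sin theta * (1 - beta j) ^+ n * step_sin j)
                  (cos theta * step_sin j - sin theta * (1 - beta j) ^+ n * step_cos j).
have [b0 b1] := beta01 j.
have cs := cos2Dsin2 (j.+1%:R * theta); rewrite -/(step_cos j) -/(step_sin j) in cs.
have y0 : h j = y 0%N.
  rewrite /h /y expr0 mulr1.
  have -> : j%:R * theta = j.+1%:R * theta - theta by rewrite -natr1; ring.
  by rewrite cosB sinB; congr plane; rewrite /step_cos /step_sin -/theta; ring.
have abs_le (x : R) : -1 <= x -> x <= 1 -> `|x| <= 1 by rewrite ler_norml => -> ->.
have cos_abs (x : R) : `|cos x| <= 1 by rewrite abs_le// ?cos_geN1 ?cos_le1.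
have sin_abs (x : R) : `|sin x| <= 1 by rewrite abs_le// ?sin_geN1 ?sin_le1.
have b_pow n : `|(1 - beta j) ^+ n| <= 1.
  by rewrite normrX exprn_ile1// ger0_norm ?subr_ge0// gerBl ltW.
have prod_le (a b : R) : `|a| <= 1 -> `|b| <= 1 -> `|a * b| <= 1.
  by move=> ha hb; rewrite normrM mulr_ile1.
have dir_le i : nrm (kill_dir i) <= 2.
  rewrite (le_trans (nrm_plane _ _))// normrN.
  have := lerD (sin_abs (i.+1%:R * theta)) (cos_abs (i.+1%:R * theta)).
  by rewrite -/(step_cos i) -/(step_sin i); lra.
have stepy n : nrm (B j (y n) - y n.+1) <= 8 * (e + \sum_(i < j) beta i).
  set a := cos theta * step_cos j + sin theta * (1 - beta j) ^+ n * step_sin j.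
  set b := cos theta * step_sin j - sin theta * (1 - beta j) ^+ n * step_cos j.
  have a2 : `|a| <= 2.
    apply: le_trans (ler_normD _ _) _.
    have := prod_le _ _ (cos_abs theta) (cos_abs (j.+1%:R * theta)).
    have := prod_le _ _ (prod_le _ _ (sin_abs theta) (b_pow n)) (sin_abs (j.+1%:R * theta)).
    by rewrite -/(step_cos j) -/(step_sin j); lra.
  have b2 : `|b| <= 2.
    apply: le_trans (ler_normB _ _) _.
    have := prod_le _ _ (cos_abs theta) (sin_abs (j.+1%:R * theta)).
    have := prod_le _ _ (prod_le _ _ (sin_abs theta) (b_pow n)) (cos_abs (j.+1%:R * theta)).
    by rewrite -/(step_cos j) -/(step_sin j); lra.
  have By : B j (y n) = of_real a *: B j p + of_real b *: B j q.
    by rewrite /y /plane (contraction_add (hB j)) !(contraction_scale (hB j)).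
  (* The ideal map kills only along [kill_dir j], whereas the model of [B j] also kills along the
     earlier directions; these contributions are added back and estimated as errors. *)
  have yS : y n.+1 = of_real a *: (p - \sum_(i < j.+1) of_real (beta i * step_sin i) *: kill_dir i)
      + of_real b *: (q - \sum_(i < j.+1) of_real (beta i * - step_cos i) *: kill_dir i)
      + \sum_(i < j) of_real (beta i * (a * step_sin i - b * step_cos i)) *: kill_dir i.
    rewrite !scalerBr addrACA -opprD -/(plane a b) !scaler_sumr -big_split /=.
    rewrite big_ord_recr /= (eq_bigr (fun i : 'I_j =>
      of_real (beta i * (a * step_sin i - b * step_cos i)) *: kill_dir i)); last first.
      move=> i _; rewrite !scalerA -scalerDl -!rmorphM -rmorphD.
      by congr (of_real _ *: _); ring.
    rewrite opprD addrA addrAC subrK.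
    rewrite !scalerA -!rmorphM -scalerDl -rmorphD planeZ planeB.
    have rho : a * (beta j * step_sin j) + b * (beta j * - step_cos j) =
        beta j * (sin theta * (1 - beta j) ^+ n).
      transitivity (beta j * (sin theta * (1 - beta j) ^+ n) *
          (step_cos j ^+ 2 + step_sin j ^+ 2)); first by rewrite /a /b; ring.
      by rewrite cs mulr1.
    by rewrite rho /y /a /b exprSr; congr plane; ring.
  rewrite By yS opprD addrA opprD addrACA -!scalerBr.
  apply: le_trans (ler_nrmB _ _) _.
  have t1 := Bp jk; have t2 := Bq jk.
  have t3 : nrm (\sum_(i < j) of_real (beta i * (a * step_sin i - b * step_cos i)) *: kill_dir i)
      <= 8 * \sum_(i < j) beta i.
    rewrite (le_trans (ler_nrm_sum _ _ _))// mulr_sumr ler_sum// => i _.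
    have [bi0 _] := beta01 i.
    rewrite nrmZr normrM (gtr0_norm bi0) -mulrA [leRHS]mulrC ler_pM2l//.
    have : `|a * step_sin i - b * step_cos i| <= 4.
      rewrite (le_trans (ler_normB _ _))// !normrM.
      have := sin_abs (i.+1%:R * theta); have := cos_abs (i.+1%:R * theta).
      rewrite -/(step_sin i) -/(step_cos i).
      have := normr_ge0 (step_sin i); have := normr_ge0 (step_cos i).
      have := normr_ge0 a; have := normr_ge0 b; nra.
    have := dir_le i; have := nrm_ge0 (kill_dir i).
    have := normr_ge0 (a * step_sin i - b * step_cos i); nra.
  have t4 : nrm (of_real a *: (B j p - (p - \sum_(i < j.+1) of_real (beta i * step_sin i) *: kill_dir i))
      + of_real b *: (B j q - (q - \sum_(i < j.+1) of_real (beta i * - step_cos i) *: kill_dir i)))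
     <= 4 * e.
    rewrite (le_trans (ler_nrmD _ _))// !nrmZr.
    have := normr_ge0 a; have := normr_ge0 b.
    move: t1 t2; set u := nrm _; set v := nrm _ => t1 t2.
    have : 0 <= u by exact: nrm_ge0.
    have : 0 <= v by exact: nrm_ge0.
    nra.
  rewrite mulrDr; apply: le_trans (lerD t4 t3) _; rewrite lerD2r; have := e0; lra.
have iter_y n : nrm (iter n (B j) (h j) - y n) <= n%:R * 8 * (e + \sum_(i < j) beta i).
  elim: n => [|n ih]; first by rewrite /= y0 subrr nrm0 !mul0r.
  rewrite (le_trans (nrm_triangle (B j (y n)) _ _))// -natr1 -mulrA mulrDl mul1r.
  rewrite lerD// ?mulrA// /= -(contraction_sub _ _ (hB j)).
  exact: le_trans (contraction_le (hB j) _) ih.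
apply: le_trans (scales jk); apply: le_trans (nrm_triangle (y (m j)) _ _) _.
rewrite lerD//.
have -> : y (m j) - of_real (cos theta) *: h j.+1 =
    of_real (sin theta * (1 - beta j) ^+ m j) *: kill_dir j.
  rewrite /h /kill_dir !planeZ planeB -/(step_cos j) -/(step_sin j).
  by congr plane; rewrite /step_cos /step_sin -/theta; ring.
rewrite nrmZr normrM mulrC.
have pw0 : 0 <= (1 - beta j) ^+ m j by rewrite exprn_ge0// subr_ge0.
rewrite (ger0_norm pw0) mulrA ler_wpM2r//.
apply: le_trans (ler_pM (nrm_ge0 _) (normr_ge0 _) (dir_le j) (sin_abs theta)) _.
by rewrite mulr1.
Qed.

(** The vectors [h j] lead from [p] to [q], since [k] steps make a right angle. Each step
    contributes a factor [cos theta] and an error [kappa], which later contractions do not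
    enlarge. *)
Lemma rotation_run :
  nrm (run B m k p - q) <= k%:R * kappa + (1 - cos theta ^+ k).
Proof.
have kappa0 : 0 <= kappa by have := rotation_step k0; exact/le_trans/nrm_ge0.
have k1 : 1 <= k%:R :> R by rewrite ler1n.
have c0 : 0 <= cos theta.
  apply: cos_ge0_pihalf.
  have t0 : 0 <= theta by rewrite !divr_ge0 ?pi_ge0.
  rewrite (le_trans _ t0) ?oppr_le0 ?divr_ge0 ?pi_ge0//=.
  by rewrite ler_pdivrMr ?(lt_le_trans _ k1)// ler_peMr ?divr_ge0 ?pi_ge0.
have c1 : cos theta <= 1 by exact: cos_le1.
have along j : (j <= k)%N ->
    nrm (run B m j p - of_real (cos theta ^+ j) *: h j) <= j%:R * kappa.
  elim: j => [_|j ih jk].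
    by rewrite expr0 rmorph1 scale1r /h /plane !mul0r cos0 sin0 rmorph1 rmorph0
      scale1r scale0r addr0 subrr nrm0.
  have hI := iter_linear_contraction (m j) (hB j).
  rewrite (le_trans (nrm_triangle (iter (m j) (B j) (of_real (cos theta ^+ j) *: h j)) _ _))//.
  rewrite -natr1 mulrDl mul1r lerD//=.
    rewrite -(contraction_sub _ _ hI) (le_trans (contraction_le hI _))// ih// ltnW//.
  rewrite (contraction_scale hI) exprSr rmorphM -scalerA -scalerBr nrmZr.
  rewrite ger0_norm ?exprn_ge0//.
  have := rotation_step jk; have := exprn_ile1 j c0 c1; have := exprn_ge0 j c0.
  by have := nrm_ge0 (iter (m j) (B j) (h j) - of_real (cos theta) *: h j.+1); nra.
have hk : h k = q.
  rewrite /h /theta mulrC divfK ?gt_eqF ?ltr0n// cos_pihalf sin_pihalf.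
  by rewrite /plane rmorph0 rmorph1 scale0r scale1r add0r.
rewrite (le_trans (nrm_triangle (of_real (cos theta ^+ k) *: h k) _ _))// lerD ?along//.
rewrite hk -{2}(scale1r q) -(rmorph1 of_real) -scalerBl -rmorphB nrmZr distrC.
by rewrite ger0_norm ?subr_ge0 ?exprn_ile1// ler_piMr// subr_ge0 exprn_ile1.
Qed.

End Rotation.

(** * The divergent sequence *)

Section Ranks.
Variable k : nat -> nat.
Local Open Scope nat_scope.

(** Ranks code pairs of slot and position lexicographically. A slot numbered at least [n] holds the
    positions up to [k n] inclusive, since twin positions start at 1. *)
Definition slot_size s := (\sum_(n < s.+1) k n).+1.
Definition rank s i := \sum_(r < s) slot_size r + i.

(* Odd stages are ranked before the even stages next to them. *)
Definition kill_rank n i := rank (4 * n + (if odd n then 0 else 5)) i.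
Definition twin_rank n i := rank (4 * n + 6) i.+1.
Definition rest_rank n := rank (4 * n + 10) 0.

Lemma leq_rank s i : s <= rank s i.
Proof.
rewrite (leq_trans _ (leq_addr _ _))//.
rewrite -[leqLHS]card_ord -sum1_card leq_sum// => r _; exact: ltn0Sn.
Qed.

Lemma ltn_rank s s' i i' : s < s' -> i < slot_size s -> rank s i < rank s' i'.
Proof.
move=> ss' si; apply: (@leq_trans (rank s'.-1.+1 0)); last first.
  by rewrite prednK ?(leq_ltn_trans _ ss')// leq_add2l.
have : s <= s'.-1 by rewrite -ltnS prednK// (leq_ltn_trans _ ss').
rewrite /rank addn0 => {ss'}; elim: s'.-1 => [|r ih].
  by rewrite leqn0 => /eqP e; rewrite e in si *; rewrite big_ord0 big_ord_recr big_ord0.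
rewrite leq_eqVlt => /orP[/eqP e|sr].
  by rewrite -e [ltnRHS]big_ord_recr /= ltn_add2l.
by rewrite [ltnRHS]big_ord_recr /= (leq_trans (ih _))// leq_addr.
Qed.

Lemma slot_size_gt n s i : n <= s -> i < k n -> i.+1 < slot_size s.
Proof.
move=> ns ik; rewrite ltnS (leq_trans ik)//.
have ns' : n < s.+1 by [].
by rewrite (bigD1 (Ordinal ns'))//= leq_addr.
Qed.

Lemma rank_inj s s' i i' : i < slot_size s -> i' < slot_size s' ->
  (rank s i == rank s' i') = (s == s') && (i == i').
Proof.
move=> si s'i'; have [->|] := eqVneq s s'; first by rewrite eqn_add2l.
rewrite neq_ltn => /orP[lt|lt].
  by rewrite ltn_eqF// ltn_rank.
by rewrite gtn_eqF// ltn_rank.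
Qed.

Let kill_size n i : i < k n -> i < slot_size (4 * n + (if odd n then 0 else 5)).
Proof. by move=> ik; rewrite ltnW// (@slot_size_gt n)//; lia. Qed.

Let twin_size n i : i < k n -> i.+1 < slot_size (4 * n + 6).
Proof. by move=> ik; rewrite (@slot_size_gt n)//; lia. Qed.

Lemma kill_rank_eq n i n' i' : i < k n -> i' < k n' ->
  (kill_rank n i == kill_rank n' i') = (n == n') && (i == i').
Proof.
move=> ik ik'; rewrite rank_inj ?kill_size//; congr andb.
apply/eqP/eqP => [|->//]; by do 2!case: ifP => _; lia.
Qed.

Lemma twin_rank_eq n i n' i' : i < k n -> i' < k n' ->
  (twin_rank n i == twin_rank n' i') = (n == n') && (i == i').
Proof.
move=> ik ik'; rewrite rank_inj ?twin_size//; congr andb.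
by apply/eqP/eqP => [|->//]; lia.
Qed.

Lemma rest_rank_eq n n' : (rest_rank n == rest_rank n') = (n == n').
Proof. by rewrite rank_inj// andbT; apply/eqP/eqP => [|->//]; lia. Qed.

Lemma kill_twin_rank_neq n i n' i' : i < k n -> i' < k n' ->
  (kill_rank n i == twin_rank n' i') = false.
Proof.
move=> ik ik'; rewrite rank_inj ?kill_size ?twin_size//.
by apply/negbTE; rewrite negb_and; apply/orP; left; apply/eqP; case: ifP => _; lia.
Qed.

Lemma kill_rest_rank_neq n i n' : i < k n -> (kill_rank n i == rest_rank n') = false.
Proof.
move=> ik; rewrite rank_inj ?kill_size//.
by apply/negbTE; rewrite negb_and; apply/orP; left; apply/eqP; case: ifP => _; lia.
Qed.

(** A twin slot can coincide with the rest slot of the preceding index; there the rest has position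
    0 and the twins have positive positions. *)
Lemma twin_rest_rank_neq n i n' : i < k n -> (twin_rank n i == rest_rank n') = false.
Proof. by move=> ik; rewrite rank_inj ?twin_size//= andbF. Qed.

Lemma kill_rank_le n i j : i <= j -> kill_rank n i <= kill_rank n j.
Proof. by rewrite leq_add2l. Qed.

Lemma kill_rank_lt n i j : i < j -> kill_rank n i < kill_rank n j.
Proof. by rewrite ltn_add2l. Qed.

Lemma kill_lt_twin n i j : j < k n -> kill_rank n j < twin_rank n i.
Proof. by move=> jk; rewrite ltn_rank ?kill_size//; case: ifP => //; lia. Qed.

Lemma kill_lt_rest n j : j < k n -> kill_rank n j < rest_rank n.
Proof. by move=> jk; rewrite ltn_rank ?kill_size//; case: ifP => //; lia. Qed.

Lemma killS_lt_rest n j : j < k n.+1 -> kill_rank n.+1 j < rest_rank n.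
Proof. by move=> jk; rewrite ltn_rank ?kill_size//; case: ifP => //; lia. Qed.

(** The tight case is [n = n'.+1], with slots [4 * n' + 4] and [4 * n' + 5]; this explains the
    offset 5 of even stages. *)
Lemma odd_kill_lt_kill n n' i j : odd n -> ~~ odd n' -> n <= n'.+1 -> j < k n ->
  kill_rank n j < kill_rank n' i.
Proof. by move=> on on' nn jk; rewrite ltn_rank ?kill_size// on (negbTE on'); lia. Qed.

Lemma odd_kill_lt_twin n n' i j : odd n -> n <= n'.+1 -> j < k n ->
  kill_rank n j < twin_rank n' i.
Proof. by move=> on nn jk; rewrite ltn_rank ?kill_size// on; lia. Qed.

Lemma leq_kill_rank n i : n <= kill_rank n i.
Proof. by rewrite (leq_trans _ (leq_rank _ _))//; lia. Qed.

Lemma leq_twin_rank n i : n <= twin_rank n i.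
Proof. by rewrite (leq_trans _ (leq_rank _ _))//; lia. Qed.

Lemma leq_rest_rank n : n <= rest_rank n.
Proof. by rewrite (leq_trans _ (leq_rank _ _))//; lia. Qed.

End Ranks.

(** * The orthonormal frame inside the third subspace *)

Section Frame.
Context {R : realType} {s : scalar_kind} {H : hilbertType R s}.
Variables (k : nat -> nat) (beta : nat -> nat -> R).
Hypothesis beta01 : forall n i, 0 < beta n i /\ beta n i <= 1.
Hypothesis sum_beta : forall n, \sum_(i < k n) beta n i <= 4^-1.
Implicit Types (phi psi : nat -> H).

Let amp n i := Num.sqrt (beta n i).
Let scos n i : R := step_cos (k n) i.
Let ssin n i : R := step_sin (k n) i.

Definition rest_coef n : R :=
  Num.sqrt (1 - \sum_(i < k n) beta n i - \sum_(i < k n.+1) beta n.+1 i).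

(* The stage between [frame phi n] and [frame phi n.+1] is numbered [n.+1].  The
   kill ranks carry [sqrt (beta i)] times the coordinates of the direction [g_i]
   to be killed; the twin ranks carry those of the orthogonal direction, which
   makes the contributions of a stage orthogonal, and the rest rank completes
   each vector to norm 1. *)
Definition frame phi n : H :=
  \sum_(i < k n) (of_real (amp n i * - scos n i) *: phi (kill_rank k n i) +
                  of_real (amp n i * ssin n i) *: phi (twin_rank k n i)) +
  \sum_(i < k n.+1) (of_real (amp n.+1 i * ssin n.+1 i) *: phi (kill_rank k n.+1 i) +
                     of_real (amp n.+1 i * scos n.+1 i) *: phi (twin_rank k n.+1 i)) +
  of_real (rest_coef n) *: phi (rest_rank k n).

Lemma frame_linear (f : H -> H) phi n :
    (forall x y, f (x + y) = f x + f y) -> (forall a x, f (a *: x) = a *: f x) ->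
  f (frame phi n) = frame (f \o phi) n.
Proof.
move=> fD fZ; have f0 : f 0 = 0 by rewrite -(scale0r 0) fZ !scale0r.
rewrite /frame !fD !fZ !(big_morph f fD f0); congr (_ + _ + _);
  by apply: eq_bigr => i _; rewrite fD !fZ.
Qed.

Lemma frameB phi psi n : frame phi n - frame psi n = frame (fun a => phi a - psi a) n.
Proof.
have frameD x y : frame x n + frame y n = frame (fun a => x a + y a) n.
  rewrite /frame addrACA -scalerDr; congr (_ + _).
  rewrite addrACA -!big_split /=; congr (_ + _);
    by apply: eq_bigr => i _; rewrite addrACA -!scalerDr.
have -> : - frame psi n = frame (fun a => - psi a) n.
  by rewrite (@frame_linear -%R psi n)// => [x y|a x]; rewrite ?opprD ?scalerN.
exact: frameD.
Qed.

Lemma amp_gt0 n i : 0 < amp n i.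
Proof. by rewrite sqrtr_gt0; have [] := beta01 n i. Qed.

Lemma amp_le1 n i : amp n i <= 1.
Proof. by rewrite -[leRHS]sqrtr1 ler_sqrt//; have [] := beta01 n i. Qed.

Lemma scos_abs n i : `|scos n i| <= 1.
Proof. by rewrite ler_norml cos_geN1 cos_le1. Qed.

Lemma ssin_abs n i : `|ssin n i| <= 1.
Proof. by rewrite ler_norml sin_geN1 sin_le1. Qed.

Lemma sum_beta_ge0 n : 0 <= \sum_(i < k n) beta n i.
Proof. by apply: sumr_ge0 => i _; apply: ltW; have [] := beta01 n i. Qed.

Lemma rest_coef_sqr n : rest_coef n ^+ 2 =
  1 - \sum_(i < k n) beta n i - \sum_(i < k n.+1) beta n.+1 i.
Proof. by rewrite sqr_sqrtr//; have := sum_beta n; have := sum_beta n.+1; lra. Qed.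

Lemma rest_coef_le1 n : `|rest_coef n| <= 1.
Proof.
rewrite ger0_norm ?sqrtr_ge0// -(@ler_pXn2r _ 2) ?nnegrE ?sqrtr_ge0//.
rewrite rest_coef_sqr expr1n.
by have := sum_beta_ge0 n; have := sum_beta_ge0 n.+1; lra.
Qed.

(** Vectors enter with their weights [amp], because those of the odd stages next to an even stage
    are controlled only through small weights. *)
Lemma frame_le phi n (d : R) :
    (forall i, (i < k n)%N -> amp n i * nrm (phi (kill_rank k n i)) <= d) ->
    (forall i, (i < k n)%N -> amp n i * nrm (phi (twin_rank k n i)) <= d) ->
    (forall i, (i < k n.+1)%N -> amp n.+1 i * nrm (phi (kill_rank k n.+1 i)) <= d) ->
    (forall i, (i < k n.+1)%N -> amp n.+1 i * nrm (phi (twin_rank k n.+1 i)) <= d) ->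
    nrm (phi (rest_rank k n)) <= d ->
  nrm (frame phi n) <= (2 * k n + 2 * k n.+1 + 1)%:R * d.
Proof.
move=> h1 h2 h3 h4 h5.
have term_le (a b : R) (y : H) : 0 <= a -> `|b| <= 1 -> a * nrm y <= d ->
    nrm (of_real (a * b) *: y) <= d.
  move=> a0 b1 axd; rewrite nrmZr normrM (ger0_norm a0).
  apply: le_trans axd; rewrite -mulrA ler_wpM2l//.
  by rewrite ler_piMl ?nrm_ge0.
have pair_le (y z : H) : nrm y <= d -> nrm z <= d -> nrm (y + z) <= 2 * d.
  by move=> yd zd; rewrite (le_trans (ler_nrmD _ _))// mulr_natl mulr2n lerD.
have sum_le m (f : 'I_m -> H) : (forall i, nrm (f i) <= 2 * d) ->
    nrm (\sum_i f i) <= m%:R * (2 * d).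
  move=> fd; rewrite (le_trans (ler_nrm_sum _ _ _))//.
  apply: (@le_trans _ _ (\sum_(i < m) 2 * d)); first by rewrite ler_sum.
  by rewrite sumr_const card_ord -[leLHS]mulr_natl.
have amp0 m i := ltW (amp_gt0 m i).
have -> : (2 * k n + 2 * k n.+1 + 1)%:R * d =
    (k n)%:R * (2 * d) + (k n.+1)%:R * (2 * d) + d.
  by rewrite !natrD; ring.
rewrite /frame (le_trans (ler_nrmD _ _))// lerD//; last first.
  by rewrite nrmZr (le_trans _ h5)// ler_piMl ?nrm_ge0// rest_coef_le1.
rewrite (le_trans (ler_nrmD _ _))// lerD// sum_le// => i; apply: pair_le; apply: term_le => //;
  rewrite ?normrN ?scos_abs ?ssin_abs//.
- exact: h1.
- exact: h2.
- exact: h3.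
- exact: h4.
Qed.

Section Orthonormal.
Variable x : nat -> H.
Hypothesis x_orthonormal : forall a b, inner (x a) (x b) = (a == b)%:R.

Let sum_delta (c : nat -> R) (b : bool) m i : (b -> (i < m)%N) ->
  \sum_(i' < m) c i' * (b && (i == i' :> nat))%:R = c i * b%:R.
Proof.
case: b => [/(_ isT) im|_]; last by rewrite mulr0 big1// => i' _; rewrite mulr0.
rewrite (bigD1 (Ordinal im))//= eqxx big1 ?addr0// => i' ne.
rewrite [i == _](_ : _ = false) ?mulr0//; apply/negbTE; apply: contra ne => /eqP e.
by apply/eqP/val_inj.
Qed.

Lemma inner_frame y n : inner y (frame x n) =
  \sum_(i < k n) (of_real (amp n i * - scos n i) * inner y (x (kill_rank k n i)) +
                  of_real (amp n i * ssin n i) * inner y (x (twin_rank k n i))) +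
  \sum_(i < k n.+1) (of_real (amp n.+1 i * ssin n.+1 i) * inner y (x (kill_rank k n.+1 i)) +
                     of_real (amp n.+1 i * scos n.+1 i) * inner y (x (twin_rank k n.+1 i))) +
  of_real (rest_coef n) * inner y (x (rest_rank k n)).
Proof.
rewrite /frame !innerDr !inner_sumr innerZr scalar_conj_real; congr (_ + _ + _);
  by apply: eq_bigr => i _; rewrite innerDr !innerZr !scalar_conj_real.
Qed.

Lemma inner_kill_frame n i m : (i < k n)%N ->
  inner (x (kill_rank k n i)) (frame x m) =
  of_real (amp n i * (- scos n i * (n == m)%:R + ssin n i * (n == m.+1)%:R)).
Proof.
move=> ik; rewrite inner_frame !x_orthonormal kill_rest_rank_neq// mulr0 addr0.
under eq_bigr => i' _.
  rewrite !x_orthonormal kill_rank_eq// kill_twin_rank_neq// mulr0 addr0.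
  rewrite -(rmorph_nat of_real) -rmorphM. over.
rewrite -rmorph_sum (sum_delta (fun i' => amp m i' * - scos m i')) => [|/eqP <-//].
under eq_bigr => i' _.
  rewrite !x_orthonormal kill_rank_eq// kill_twin_rank_neq// mulr0 addr0.
  rewrite -(rmorph_nat of_real) -rmorphM. over.
rewrite -rmorph_sum (sum_delta (fun i' => amp m.+1 i' * ssin m.+1 i')) => [|/eqP <-//].
rewrite -rmorphD mulrDr !mulrA; congr (of_real (_ + _)).
  by case: eqP => [->//|_]; rewrite !mulr0.
by case: eqP => [->//|_]; rewrite !mulr0.
Qed.

Lemma inner_twin_frame n i m : (i < k n)%N ->
  inner (x (twin_rank k n i)) (frame x m) =
  of_real (amp n i * (ssin n i * (n == m)%:R + scos n i * (n == m.+1)%:R)).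
Proof.
move=> ik; rewrite inner_frame !x_orthonormal twin_rest_rank_neq// mulr0 addr0.
under eq_bigr => i' _.
  rewrite !x_orthonormal twin_rank_eq// eq_sym kill_twin_rank_neq// mulr0 add0r.
  rewrite -(rmorph_nat of_real) -rmorphM. over.
rewrite -rmorph_sum (sum_delta (fun i' => amp m i' * ssin m i')) => [|/eqP <-//].
under eq_bigr => i' _.
  rewrite !x_orthonormal twin_rank_eq// eq_sym kill_twin_rank_neq// mulr0 add0r.
  rewrite -(rmorph_nat of_real) -rmorphM. over.
rewrite -rmorph_sum (sum_delta (fun i' => amp m.+1 i' * scos m.+1 i')) => [|/eqP <-//].
rewrite -rmorphD mulrDr !mulrA; congr (of_real (_ + _)).
  by case: eqP => [->//|_]; rewrite !mulr0.
by case: eqP => [->//|_]; rewrite !mulr0.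
Qed.

Lemma inner_rest_frame n m :
  inner (x (rest_rank k n)) (frame x m) = of_real (rest_coef n * (n == m)%:R).
Proof.
rewrite inner_frame !x_orthonormal rest_rank_eq big1 => [|i _]; last first.
  by rewrite !x_orthonormal ![rest_rank k n == _]eq_sym
    kill_rest_rank_neq// twin_rest_rank_neq// !mulr0 addr0.
rewrite big1 => [|i _]; last first.
  by rewrite !x_orthonormal ![rest_rank k n == _]eq_sym
    kill_rest_rank_neq// twin_rest_rank_neq// !mulr0 addr0.
rewrite !add0r -(rmorph_nat of_real) -rmorphM.
by case: eqP => [->//|_]; rewrite !mulr0.
Qed.

(** At each pair of kill and twin ranks two consecutive vectors have coordinates (sin, cos) and
    (-cos, sin) up to a common weight, hence are orthogonal; vectors further apart share no rank.
    The rest coefficient normalizes. *)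
Lemma frame_orthonormal n m : inner (frame x n) (frame x m) = (n == m)%:R.
Proof.
have cs n' i : scos n' i ^+ 2 + ssin n' i ^+ 2 = 1 by exact: cos2Dsin2.
have amp2 n' i : amp n' i ^+ 2 = beta n' i.
  by rewrite sqr_sqrtr// ltW//; have [] := beta01 n' i.
have first_end (i : 'I_(k n)) :
    inner (of_real (amp n i * - scos n i) *: x (kill_rank k n i) +
           of_real (amp n i * ssin n i) *: x (twin_rank k n i)) (frame x m) =
    of_real (beta n i * (n == m)%:R).
  rewrite innerDl !innerZl inner_kill_frame// inner_twin_frame// -!rmorphM -rmorphD.
  congr of_real; rewrite -amp2.
  move: (cs n i) (n == m)%:R (n == m.+1)%:R => cs1 b b'.
  transitivity (amp n i ^+ 2 * (scos n i ^+ 2 + ssin n i ^+ 2) * b); first by ring.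
  by rewrite cs1 mulr1.
have second_end (i : 'I_(k n.+1)) :
    inner (of_real (amp n.+1 i * ssin n.+1 i) *: x (kill_rank k n.+1 i) +
           of_real (amp n.+1 i * scos n.+1 i) *: x (twin_rank k n.+1 i)) (frame x m) =
    of_real (beta n.+1 i * (n == m)%:R).
  rewrite innerDl !innerZl inner_kill_frame// inner_twin_frame// -!rmorphM -rmorphD.
  congr of_real; rewrite -amp2 eqSS.
  move: (cs n.+1 i) (n.+1 == m)%:R (n == m)%:R => cs1 b b'.
  transitivity (amp n.+1 i ^+ 2 * (scos n.+1 i ^+ 2 + ssin n.+1 i ^+ 2) * b'); first by ring.
  by rewrite cs1 mulr1.
rewrite {1}/frame !innerDl !inner_suml innerZl inner_rest_frame -rmorphM.
rewrite (eq_bigr _ (fun i _ => first_end i)) (eq_bigr _ (fun i _ => second_end i)).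
rewrite -!rmorph_sum -!rmorphD -!mulr_suml mulrA -expr2 rest_coef_sqr -!mulrDl.
rewrite -(rmorph_nat of_real); congr of_real.
by rewrite -[RHS]mul1r; congr (_ * _); ring.
Qed.

(** Only the frame vectors [n] and [n.+1] have a coordinate at this rank. Since the projected vector
    carries a factor [sqrt beta], killing the rank amounts, after compression, to [beta] times the
    rank-one operator of [kill_dir]. *)
Lemma proj_frame_kill n i : (i < k n.+1)%N ->
  Defs.proj (orthocomp (orthocomp (range (frame x)))) (x (kill_rank k n.+1 i)) =
  of_real (amp n.+1 i) *: kill_dir (frame x n) (frame x n.+1) (k n.+1) i.
Proof.
move=> ik; apply: proj_biorthocomp.
  have [_ D Z] := closed_subspace_submod (orthocomp_closed_subspace (orthocomp (range (frame x)))).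
  by apply/Z/D; apply: Z; apply: sub_biorthocomp; [exists n|exists n.+1].
move=> _ [m _ <-]; apply: inner_eq0C.
rewrite innerBl inner_kill_frame// innerZl innerDl !innerZl !frame_orthonormal.
rewrite -!(rmorph_nat of_real) -!rmorphM -rmorphD -rmorphM -rmorphB eqSS.
by rewrite (_ : _ - _ = 0) ?rmorph0//; rewrite /ssin /scos; ring.
Qed.

End Orthonormal.

End Frame.

(** * Subspaces spanned by tuples and the effect of damped words *)

Section SpreadProjections.
Context {R : realType} {s : scalar_kind} {H : hilbertType R s}.
Variables (K : nat) (L : 'I_K -> set H) (tau : nat -> R) (i j l : 'I_K).
Variables (u : nat -> 'I_K -> H) (t : nat -> nat).
Hypothesis hL : forall k', closed_subspace (L k').
Hypothesis uP : spread L tau i j u t.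
Hypotheses (li : l != i) (lj : l != j).
Variables (k : nat -> nat) (beta : nat -> nat -> R).
Hypothesis beta01 : forall n i', 0 < beta n i' /\ beta n i' <= 1.
Hypothesis sum_beta : forall n, \sum_(i' < k n) beta n i' <= 4^-1.

(* A double orthocomplement stands for the closed span. *)
Definition spread_subspace (k' : 'I_K) : set H :=
  orthocomp (orthocomp (if (k' == i) || (k' == j) then range (u ^~ k')
                        else range (frame k beta (u ^~ k')))).

Local Notation M := spread_subspace.
Local Notation x := (u ^~ l).

Lemma spread_subspace_closed k' : closed_subspace (M k').
Proof. exact: orthocomp_closed_subspace. Qed.

Let hM := spread_subspace_closed.

Lemma submod_frame (X : set H) phi n :
  submod X -> (forall a, X (phi a)) -> X (frame k beta phi n).
Proof.
move=> sX Xphi; have [_ D Z] := sX.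
apply/D; last exact/Z.
by apply/D; apply: submod_sum => // i'; apply/D; exact/Z.
Qed.

Lemma spread_subspace_sub k' : M k' `<=` L k'.
Proof.
apply: biorthocomp_sub => //; case: ifP => _ _ [a _ <-]; first exact: spread_in uP _ _.
by apply: submod_frame; [exact: closed_subspace_submod|move=> b; exact: spread_in uP _ _].
Qed.

Lemma frame_in_spread_subspace k' n : M k' (frame k beta (u ^~ k') n).
Proof.
rewrite /M; case: ifP => _; last by apply: sub_biorthocomp; exists n.
apply: submod_frame; first exact/closed_subspace_submod/orthocomp_closed_subspace.
by move=> a; apply: sub_biorthocomp; exists a.
Qed.

Lemma spread_orthonormal k' a b : inner (u a k') (u b k') = (a == b)%:R.
Proof.
case: eqP => [->|/eqP ab]; last exact: spread_ortho uP _ _ _ _ ab.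
by rewrite inner_self (spread_unit uP) expr1n rmorph1.
Qed.

Lemma proj_spread k' a k'' : (k' == i) || (k' == j) ->
  proj (M k') (u a k'') = inner (u a k'') (u a k') *: u a k'.
Proof.
move=> kij; rewrite /M kij; apply: proj_biorthocomp.
  have [_ _ Z] := closed_subspace_submod (orthocomp_closed_subspace (orthocomp (range (u ^~ k')))).
  by apply/Z/sub_biorthocomp; exists a.
move=> _ [b _ <-]; apply: inner_eq0C; rewrite innerBl innerZl spread_orthonormal.
case: eqP => [->|/eqP ab]; first by rewrite mulr1 subrr.
by rewrite (spread_ortho uP) // mulr0 subr0.
Qed.

(** The vector [u a i] minus its component along [u a l] is orthogonal to all [u b l], hence to the
    frame built from them. *)
Lemma proj_selector a : proj (M l) (u a i) = inner (u a i) (u a l) *: proj (M l) (u a l).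
Proof.
apply/eqP; rewrite -subr_eq0 -(projZ (hM l)) -(projB (hM l)); apply/eqP.
rewrite /M (negbTE li) (negbTE lj) /=; apply: proj_biorthocomp.
  by case: (closed_subspace_submod (orthocomp_closed_subspace (orthocomp (range (frame k beta x))))).
rewrite subr0 => _ [m _ <-]; apply: inner_eq0C.
set z := _ - _; suff : orthocomp [set z] (frame k beta x m) by exact.
apply: submod_frame => [|b _ ->].
  exact/closed_subspace_submod/orthocomp_closed_subspace.
rewrite innerBl innerZl spread_orthonormal.
case: eqP => [->|/eqP ab]; first by rewrite mulr1 subrr.
by rewrite (spread_ortho uP)// mulr0 subr0.
Qed.

Definition damping q a : R := overlap (u a) i j ^+ t q * overlap (u a) l i.

(** A power of alternating projections followed by the return to [M l]: it scales the tuple of rank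
    [a] by [damping q a], nearly erasing ranks up to [q] and nearly keeping later ones. *)
Definition damped_word q : seq 'I_K := i :: flatten (nseq (t q) [:: j; i]) ++ [:: l].

Lemma inner_overlap a k1 k2 :
  inner (u a k1) (u a k2) * inner (u a k2) (u a k1) = of_real (overlap (u a) k1 k2).
Proof. by rewrite [X in _ * X]innerC mul_scalar_conj. Qed.

Lemma damped_word_tuple q a :
  word M (damped_word q) (u a l) = of_real (damping q a) *: proj (M l) (u a l).
Proof.
have hi : (i == i) || (i == j) by rewrite eqxx.
have hj : (j == i) || (j == j) by rewrite eqxx orbT.
have alternating n : word M (flatten (nseq n [:: j; i])) (u a i) =
    of_real (overlap (u a) i j ^+ n) *: u a i.
  elim: n => [|n ih]; first by rewrite expr0 rmorph1 scale1r.
  rewrite [nseq _ _]/= [flatten _]/= (word_cat M [:: j; i]) [X in word _ _ X]/=.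
  rewrite (proj_spread a i hj) (projZ (hM i)) (proj_spread a j hi) scalerA inner_overlap.
  by rewrite (wordZ hM) ih scalerA -rmorphM -exprS.
rewrite /damped_word /= word_cat (proj_spread a l hi) (wordZ hM) alternating /=.
have -> : of_real (damping q a) = of_real (overlap (u a) i j ^+ t q) *
    (inner (u a l) (u a i) * inner (u a i) (u a l)).
  by rewrite inner_overlap -rmorphM.
rewrite !(projZ (hM l)) proj_selector !scalerA; congr (_ *: _).
by rewrite mulrCA mulrA.
Qed.

Lemma damping_ge0 q a : 0 <= damping q a.
Proof. by apply: mulr_ge0; [apply: exprn_ge0|]; exact: overlap_ge0. Qed.

Lemma spread_overlap_le1 a k1 k2 : overlap (u a) k1 k2 <= 1.
Proof. by apply: overlap_le1 => k'; exact: spread_unit uP _ _. Qed.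

Lemma overlap_expr_ge0 a n : 0 <= overlap (u a) i j ^+ n.
Proof. apply: exprn_ge0; exact: overlap_ge0. Qed.

Lemma overlap_expr_le1 a n : overlap (u a) i j ^+ n <= 1.
Proof. by apply: exprn_ile1; [exact: overlap_ge0|exact: spread_overlap_le1]. Qed.

Lemma damping_le1 q a : damping q a <= 1.
Proof.
apply: mulr_ile1; [exact: overlap_expr_ge0|exact: overlap_ge0|exact: overlap_expr_le1|].
exact: spread_overlap_le1.
Qed.

Lemma damping_killed q a : (a <= q)%N -> damping q a <= tau q.
Proof.
move=> aq; apply: le_trans (spread_killed uP aq).
by rewrite ler_piMr ?overlap_expr_ge0 ?spread_overlap_le1.
Qed.

Lemma damping_alive q a : (q < a)%N -> 1 - damping q a <= tau q + tau a.
Proof.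
move=> qa; have := spread_alive uP qa; have := spread_overlap uP a l i.
rewrite /damping; have := spread_overlap_le1 a l i; have := overlap_ge0 (u a) l i.
have := overlap_expr_le1 a (t q).
have := overlap_expr_ge0 a (t q).
move: (overlap (u a) i j ^+ t q) (overlap (u a) l i) => y z; nra.
Qed.

Section Stage.
Variables (n jj : nat) (theta : R).
Local Notation N := n.+1.
Hypothesis jk : (jj < k N)%N.
Hypothesis tau_theta : forall a, (n <= a)%N -> tau a <= theta / 2.
Hypothesis theta0 : 0 <= theta.
Hypothesis before_small : odd N \/ forall i', (i' < k n)%N -> Num.sqrt (beta n i') <= theta.
Hypothesis after_small : odd N \/ forall i', (i' < k N.+1)%N -> Num.sqrt (beta N.+1 i') <= theta.

Let q := kill_rank k N jj.
Let hat a := proj (M l) (x a).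
(** The ranks marked by [chi] are the kill ranks of the stage up to position [jj]. The error [psi]
    compares the damped vector with the ideal one, where exactly the marked ranks are dropped; it
    need not be small at unmarked ranks up to [q]. *)
Let chi a := has (fun i' => a == kill_rank k N i') (iota 0 jj.+1).
Let psi a := of_real (damping q a) *: hat a - (hat a - if chi a then hat a else 0).

Let qn : (n <= q)%N.
Proof. by rewrite ltnW// leq_kill_rank. Qed.

Let hat_le1 a : nrm (hat a) <= 1.
Proof. by rewrite (le_trans (nrm_proj_le (hM l) _))// (spread_unit uP). Qed.

Let psi_alive a : chi a = false -> (q < a)%N -> nrm (psi a) <= theta.
Proof.
move=> ca qa; rewrite /psi ca subr0 -[X in _ - X]scale1r -(rmorph1 of_real).
rewrite -scalerBl -rmorphB nrmZr distrC ger0_norm ?subr_ge0 ?damping_le1//.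
have := damping_alive qa; have := tau_theta qn; have := tau_theta (leq_trans qn (ltnW qa)).
have := damping_le1 q a; have := hat_le1 a; have := nrm_ge0 (hat a); nra.
Qed.

Let psi_killed a : chi a -> (a <= q)%N -> nrm (psi a) <= theta.
Proof.
move=> ca aq; rewrite /psi ca subrr subr0 nrmZr ger0_norm ?damping_ge0//.
have := damping_killed aq; have := tau_theta qn.
have := damping_ge0 q a; have := hat_le1 a; have := nrm_ge0 (hat a); nra.
Qed.

Let psi_le1 a : chi a = false -> nrm (psi a) <= 1.
Proof.
move=> ca; rewrite /psi ca subr0 -[X in _ - X]scale1r -(rmorph1 of_real).
rewrite -scalerBl -rmorphB nrmZr distrC ger0_norm ?subr_ge0 ?damping_le1//.
have := damping_ge0 q a.
have := damping_le1 q a; have := hat_le1 a; have := nrm_ge0 (hat a); nra.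
Qed.

Let chi_kill i' : (i' < k N)%N -> chi (kill_rank k N i') = (i' <= jj)%N.
Proof.
move=> ik; apply/hasP/idP => [[i'' + /eqP]|ij'].
  rewrite mem_iota add0n ltnS => /andP[_ i''j] /eqP.
  by rewrite kill_rank_eq ?(leq_ltn_trans i''j)// => /andP[_ /eqP ->].
by exists i'; rewrite ?eqxx// mem_iota.
Qed.

Let chiF a : (forall i', (i' < k N)%N -> (kill_rank k N i' == a) = false) -> chi a = false.
Proof.
move=> h; apply/negbTE/hasPn => i''; rewrite mem_iota add0n ltnS => /andP[_ i''j].
by rewrite eq_sym h// (leq_ltn_trans i''j).
Qed.

Let chi_other n' i' : n' != N -> (i' < k n')%N -> chi (kill_rank k n' i') = false.
Proof.
by move=> nN ik; apply: chiF => i'' ik'; rewrite kill_rank_eq// eq_sym (negbTE nN).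
Qed.

Let chi_twin n' i' : (i' < k n')%N -> chi (twin_rank k n' i') = false.
Proof. by move=> ik; apply: chiF => i'' ik'; rewrite kill_twin_rank_neq. Qed.

Let chi_rest n' : chi (rest_rank k n') = false.
Proof. by apply: chiF => i'' ik'; rewrite kill_rest_rank_neq. Qed.

Let amp_psi (a : nat) (r : R) : 0 <= r -> r <= 1 -> nrm (psi a) <= theta -> r * nrm (psi a) <= theta.
Proof. by move=> r0 r1 pt; apply: le_trans pt; rewrite ler_piMl ?nrm_ge0. Qed.

Let psi_stage_kill i' : (i' < k N)%N -> nrm (psi (kill_rank k N i')) <= theta.
Proof.
move=> ik; have [ij'|ji] := leqP i' jj.
  by apply: psi_killed; rewrite ?chi_kill// kill_rank_le.
by apply: psi_alive; [rewrite chi_kill// leqNgt ji|exact: kill_rank_lt].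
Qed.

Let psi_stage_twin i' : (i' < k N)%N -> nrm (psi (twin_rank k N i')) <= theta.
Proof. by move=> ik; apply: psi_alive; [exact: chi_twin|exact: kill_lt_twin]. Qed.

(** For odd [N] the neighbouring stages are even, so their ranks come after [q] and survive.
    Otherwise their kill vectors may already be erased, but their weights are at most [theta]. *)
Let psi_neighbour n' i' : (n' == n) || (n' == N.+1) -> (i' < k n')%N ->
  Num.sqrt (beta n' i') * nrm (psi (kill_rank k n' i')) <= theta /\
  Num.sqrt (beta n' i') * nrm (psi (twin_rank k n' i')) <= theta.
Proof.
move=> n'n ik.
have b1 : Num.sqrt (beta n' i') <= 1 := amp_le1 beta01 n' i'.
have b0 : 0 <= Num.sqrt (beta n' i') := sqrtr_ge0 _.
have n'N : n' != N by case/orP: n'n => /eqP ->; lia.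
have ck := chi_other n'N ik; have ct := chi_twin ik.
have [oN|small] : odd N \/ Num.sqrt (beta n' i') <= theta.
- case/orP: n'n => /eqP e; rewrite e in ik *.
    by case: before_small => [|h]; [left|right; exact: h].
  by case: after_small => [|h]; [left|right; exact: h].
- have on' : ~~ odd n' by case/orP: n'n => /eqP ->; move: oN => /=; rewrite ?negbK.
  have Nn' : (N <= n'.+1)%N by case/orP: n'n => /eqP ->; lia.
  split; apply: amp_psi => //; apply: psi_alive => //.
    exact: odd_kill_lt_kill.
  exact: odd_kill_lt_twin.
- split; apply: le_trans small; rewrite ler_piMr//; exact: psi_le1.
Qed.

Lemma damped_frame m :
  word M (damped_word q) (frame k beta x m) =
  frame k beta (fun a => of_real (damping q a) *: hat a) m.
Proof.
rewrite (@frame_linear _ _ _ k beta (word M (damped_word q)) x m).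
- by congr frame; apply/funext => a; exact: damped_word_tuple.
- exact: wordD.
- exact: wordZ.
Qed.

Lemma frame_hat m : frame k beta x m = frame k beta hat m.
Proof.
rewrite -{1}(proj_id (hM l) (@frame_in_spread_subspace l m)).
by rewrite (@frame_linear _ _ _ k beta (proj (M l)) x m)// => *; [exact: projD|exact: projZ].
Qed.

Let kill := kill_dir (frame k beta x n) (frame k beta x N) (k N).

Let hat_kill i' : (i' < k N)%N ->
  hat (kill_rank k N i') = of_real (Num.sqrt (beta N i')) *: kill i'.
Proof.
move=> ik; rewrite /hat /M (negbTE li) (negbTE lj) /=.
exact: (proj_frame_kill beta01 sum_beta (spread_orthonormal l) ik).
Qed.

Let killed_sum (c : nat -> R) :
  \sum_(i' < k N) of_real (Num.sqrt (beta N i') * c i') *: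
      (if chi (kill_rank k N i') then hat (kill_rank k N i') else 0) =
  \sum_(i' < jj.+1) of_real (beta N i' * c i') *: kill i'.
Proof.
rewrite (big_ord_widen _ (fun i' => of_real (beta N i' * c i') *: kill i') jk).
rewrite [RHS]big_mkcond /=; apply: eq_bigr => i' _; rewrite chi_kill// ltnS.
case: ifP => _; last by rewrite scaler0.
rewrite hat_kill// scalerA -rmorphM mulrAC -expr2 sqr_sqrtr//.
by apply: ltW; have [] := beta01 N i'.
Qed.

(** The frame of the marked vectors is exactly the killed sum, since [sqrt beta] enters once as
    coefficient and once through [hat_kill]. The error is the frame of [psi], at most [theta] in
    each term. *)
Lemma damped_frame_first :
  nrm (word M (damped_word q) (frame k beta x n) - (frame k beta x n -
    \sum_(i' < jj.+1) of_real (beta N i' * step_sin (k N) i') *: kill i'))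
  <= (2 * k n + 2 * k N + 1)%:R * theta.
Proof.
have -> : \sum_(i' < jj.+1) of_real (beta N i' * step_sin (k N) i') *: kill i' =
    frame k beta (fun a => if chi a then hat a else 0) n.
  rewrite -killed_sum /frame chi_rest scaler0 addr0.
  rewrite [X in _ = X + _]big1 ?add0r => [|i' _]; last first.
    by rewrite chi_other ?chi_twin ?scaler0 ?addr0// neq_ltn ltnSn.
  by apply: eq_bigr => i' _; rewrite chi_twin// scaler0 addr0.
rewrite damped_frame frame_hat !frameB; apply: frame_le => //.
- by move=> i' ik; have [] := psi_neighbour (_ : (n == n) || _) ik; rewrite ?eqxx.
- by move=> i' ik; have [] := psi_neighbour (_ : (n == n) || _) ik; rewrite ?eqxx.
- move=> i' ik; apply: amp_psi; rewrite ?sqrtr_ge0//; first exact: (amp_le1 beta01).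
  exact: psi_stage_kill.
- move=> i' ik; apply: amp_psi; rewrite ?sqrtr_ge0//; first exact: (amp_le1 beta01).
  exact: psi_stage_twin.
- by apply: psi_alive; [exact: chi_rest|exact: killS_lt_rest].
Qed.

Lemma damped_frame_second :
  nrm (word M (damped_word q) (frame k beta x N) - (frame k beta x N -
    \sum_(i' < jj.+1) of_real (beta N i' * - step_cos (k N) i') *: kill i'))
  <= (2 * k N + 2 * k N.+1 + 1)%:R * theta.
Proof.
have -> : \sum_(i' < jj.+1) of_real (beta N i' * - step_cos (k N) i') *: kill i' =
    frame k beta (fun a => if chi a then hat a else 0) N.
  rewrite -(killed_sum (fun i' => - step_cos (k N) i')) /frame chi_rest scaler0 addr0.
  rewrite [X in _ = _ + X]big1 ?addr0 => [|i' _]; last first.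
    by rewrite chi_other ?chi_twin ?scaler0 ?addr0// neq_ltn ltnSn orbT.
  by apply: eq_bigr => i' _; rewrite chi_twin// scaler0 addr0.
rewrite damped_frame frame_hat !frameB; apply: frame_le => //.
- move=> i' ik; apply: amp_psi; rewrite ?sqrtr_ge0//; first exact: (amp_le1 beta01).
  exact: psi_stage_kill.
- move=> i' ik; apply: amp_psi; rewrite ?sqrtr_ge0//; first exact: (amp_le1 beta01).
  exact: psi_stage_twin.
- by move=> i' ik; have [] := psi_neighbour (_ : _ || (N.+1 == N.+1)) ik; rewrite ?eqxx ?orbT.
- by move=> i' ik; have [] := psi_neighbour (_ : _ || (N.+1 == N.+1)) ik; rewrite ?eqxx ?orbT.
- by apply: psi_alive; [exact: chi_rest|exact: kill_lt_rest].
Qed.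

End Stage.

End SpreadProjections.

(** * Choice of parameters for the stages *)

Section StageTuning.
Variables (R : realType).

Definition coef_count (k : nat -> nat) n : nat := (2 * k n + 2 * k n.+1 + 1)%N.

(** Stage [N] works with the frame vectors [N.-1] and [N]; an error of this size in every term of
    either one totals at most [e N]. *)
Definition stage_tolerance (k : nat -> nat) (e : nat -> R) N : R :=
  e N / (coef_count k N.-1 + coef_count k N)%:R.

(** The admissible loss [eta N] has three equal parts: the cosines of the rotation, one pass through
    all subspaces ([c] will be their number) and the inexact killings. The last two clauses make odd
    weights negligible for even neighbours. *)
Record stage_parameters (c : R) (eta : nat -> R) (k : nat -> nat)
    (beta : nat -> nat -> R) (m : nat -> nat -> nat) (e : nat -> R) : Prop :=
  StageParameters {
  steps_gt0 : forall N, (0 < k N)%N;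
  angle_loss : forall N, 1 - cos (pi / 2 / (k N)%:R) ^+ k N <= eta N / 3;
  beta_01 : forall N i, 0 < beta N i /\ beta N i <= 1;
  beta_sum : forall N, \sum_(i < k N) beta N i <= 4^-1;
  tolerance_gt0 : forall N, 0 < e N;
  tolerance_le : forall N, c * e N <= eta N / 3;
  stage_scales : forall N j, (j < k N)%N ->
    (m N j)%:R * 8 * (e N + \sum_(i < j) beta N i) + 2 * (1 - beta N j) ^+ m N j
      <= eta N / 3 / (k N)%:R;
  odd_small : forall N i, ~~ odd N -> (i < k N.+1)%N ->
    Num.sqrt (beta N.+1 i) <= stage_tolerance k e N;
  odd_small_pred : forall N i, ~~ odd N.+1 -> (i < k N)%N ->
    Num.sqrt (beta N i) <= stage_tolerance k e N.+1
}.

(** Even stages are fixed first and their tolerances prescribe the budgets of the odd ones. This is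
    not circular, since odd stages impose no smallness on even neighbours. *)
Lemma exists_stage_parameters (c : R) (eta : nat -> R) :
    0 < c -> (forall N, 0 < eta N) ->
  exists k beta m e, stage_parameters c eta k beta m e.
Proof.
move=> c0 eta0.
have eta3 N : 0 < eta N / 3 by rewrite divr_gt0.
have /choice[k kP] N : exists k, (0 < k)%N /\ 1 - cos (pi / 2 / k%:R : R) ^+ k <= eta N / 3.
  by have [k k0 hk] := exists_fine_angle (eta3 N); exists k; split=> //; lra.
have k0 N : (0 < k N)%N := (kP N).1.
pose good N (b : R) (d : (nat -> R) * (nat -> nat) * R) := [/\ 0 < d.2,
   c * d.2 <= eta N / 3, forall i, 0 < d.1.1 i /\ d.1.1 i <= 1,
   \sum_(i < k N) d.1.1 i <= b &
   forall j, (j < k N)%N ->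
    (d.1.2 j)%:R * 8 * (d.2 + \sum_(i < j) d.1.1 i) + 2 * (1 - d.1.1 j) ^+ d.1.2 j
      <= eta N / 3 / (k N)%:R].
have /choice[G GP] (Nb : nat * R) : exists d, 0 < Nb.2 -> good Nb.1 Nb.2 d.
  case: Nb => N b /=; have [b0|_] := ltP 0 b; last by exists (fun=> 0, fun=> 0%N, 0).
  have kap0 : 0 < eta N / 3 / (k N)%:R by rewrite divr_gt0// ltr0n.
  have [beta [m [e [e0 b01 bs sc]]]] := exists_stage_scales (k N) b0 kap0.
  exists (beta, m, Num.min e (eta N / 3 / c)) => _; split=> //=.
  - by rewrite lt_min e0 divr_gt0.
  - by rewrite mulrC -ler_pdivlMr// ge_min lexx orbT.
  - move=> j /sc; apply: le_trans; rewrite lerD2r ler_wpM2l ?mulr_ge0// lerD2r.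
    by rewrite ge_min lexx.
pose even N := G (N, 4^-1).
have q0 : 0 < (4^-1 : R) by rewrite invr_gt0.
have evenP N : good N 4^-1 (even N) := GP (N, 4^-1) q0.
pose tol := stage_tolerance k (fun N => (even N).2).
have tol0 N : 0 < tol N.
  by have [h _ _ _ _] := evenP N; rewrite divr_gt0// ltr0n addn_gt0 /coef_count addn1.
(* The clauses bound the square root of [beta], so the tolerances of the two even neighbours of an
   odd [N] enter squared. *)
pose b N := Num.min 4^-1 (Num.min (tol N.-1 ^+ 2) (tol N.+1 ^+ 2)).
have b0 N : 0 < b N by rewrite !lt_min q0 !exprn_gt0.
pose d N := if odd N then G (N, b N) else even N.
have dP N : good N 4^-1 (d N).
  rewrite /d; case: ifP => _ //.
  have [h1 h2 h3 h4 h5] := GP (N, b N) (b0 N); split=> //.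
  by rewrite (le_trans h4)// ge_min lexx.
have d_tol N : ~~ odd N -> stage_tolerance k (fun N => (d N).2) N = tol N.
  by move=> oN; rewrite /tol /stage_tolerance /d (negbTE oN).
have d_odd N i : odd N -> (i < k N)%N -> (d N).1.1 i <= b N.
  move=> oN iN; have [_ _ h3 h4 _] := GP (N, b N) (b0 N).
  rewrite /d oN (le_trans _ h4)// (bigD1 (Ordinal iN))//= lerDl.
  by apply: sumr_ge0 => i' _; have [/ltW] := h3 i'.
exists k, (fun N => (d N).1.1), (fun N => (d N).1.2), (fun N => (d N).2).
have sqrt_le (y z : R) : 0 <= z -> y <= z ^+ 2 -> Num.sqrt y <= z.
  by move=> z0 yz; rewrite -(ger0_norm z0) -sqrtr_sqr ler_wsqrtr.
split=> //.
- by move=> N; have [] := kP N.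
- by move=> N; have [] := dP N.
- by move=> N; have [] := dP N.
- by move=> N; have [] := dP N.
- by move=> N; have [] := dP N.
- by move=> N; have [] := dP N.
- move=> N i oN iN; rewrite d_tol//; apply: sqrt_le; first exact: ltW.
  by rewrite (le_trans (d_odd _ _ _ iN))//= !ge_min lexx !orbT.
- move=> N i oN iN; rewrite d_tol//; apply: sqrt_le; first exact: ltW.
  rewrite /= negbK in oN.
  by rewrite (le_trans (d_odd _ _ oN iN))//= !ge_min lexx !orbT.
Qed.

End StageTuning.

(** * Concatenating infinitely many words *)

Section Concatenation.
Context {R : realType} {s : scalar_kind} {H : hilbertType R s}.
Variables (K : nat) (M : 'I_K -> set H).
Hypothesis hM : forall k, closed_subspace (M k).

Lemma word_run (bw : nat -> seq 'I_K) (m : nat -> nat) n (x : H) :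
  word M (flatten [seq flatten (nseq (m j) (bw j)) | j <- iota 0 n]) x =
  run (fun j => word M (bw j)) m n x.
Proof.
elim: n => [//|n ih]; rewrite -[n.+1]addn1 iotaD map_cat flatten_cat word_cat ih.
rewrite addn1 /= cats0 add0n; elim: (m n) (run _ _ _ _) => //= r ihr y.
by rewrite word_cat ihr -iterSr.
Qed.

Lemma word_linear_contraction l : linear_contraction (word M l).
Proof. by split; [exact: wordD|exact: wordZ|exact: nrm_word_le]. Qed.

(** A projection moves [w] by at most its distance to the subspace and does not expand [z - w]. This
    makes a pass through all letters affordable in every stage. *)
Lemma word_near_fixed l (z w : H) (e : R) :
    (forall k, exists2 v, M k v & nrm (w - v) <= e) ->
  nrm (word M l z - w) <= nrm (z - w) + (size l)%:R * e.
Proof.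
move=> we; elim: l z => [|k l ih] z /=; first by rewrite mul0r addr0.
rewrite (le_trans (ih _))// -natr1 mulrDl mul1r addrCA [leRHS]addrC lerD2r.
have [v Mv wv] := we k.
rewrite (le_trans (nrm_triangle (proj (M k) w) _ _))// lerD//.
  by rewrite -projB// nrm_proj_le.
by rewrite nrm_distC (le_trans _ wv)// nrm_sub_proj_le.
Qed.

(** Every word contains all letters, so it is nonempty, the prefixes grow without bound and each
    letter recurs. *)
Lemma concatenation (wd : nat -> seq 'I_K) (z0 : H) :
    (0 < K)%N -> (forall n k, k \in wd n) ->
  exists (k : nat -> 'I_K) (T : nat -> nat),
    [/\ forall j, infinite_set [set n | k n = j], forall n, (n <= T n)%N &
        forall n, iterates M k z0 (T n) =
          word M (flatten [seq wd i | i <- iota 0 n]) z0].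
Proof.
move=> K0 wd_all; pose pre n := flatten [seq wd i | i <- iota 0 n].
have preS n : pre n.+1 = pre n ++ wd n.
  by rewrite /pre -[n.+1]addn1 iotaD map_cat flatten_cat /= cats0.
have size_pre n : (n <= size (pre n))%N.
  elim: n => // n ih; rewrite preS size_cat -addn1 leq_add//.
  by have := wd_all n (Ordinal K0); case: (wd n).
(* The index [k p.+1] is the letter at position [p] of the infinite word, as [iterates] begins with
   index 1; the prefix [pre p.+1] is long enough to contain it. *)
pose d := Ordinal K0; pose k p := nth d (pre p) p.-1.
have nth_pre a b p : (p < size (pre a))%N -> (a <= b)%N ->
    nth d (pre b) p = nth d (pre a) p.
  move=> pa /subnKC <-; elim: (b - a)%N => [|r ih]; first by rewrite addn0.
  rewrite addnS preS nth_cat ih ifT// (leq_trans pa)//.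
  elim: r {ih} => [|r ih]; first by rewrite addn0.
  by rewrite addnS preS size_cat (leq_trans ih)// leq_addr.
have kE n p : (p < size (pre n))%N -> k p.+1 = nth d (pre n) p.
  move=> pn; rewrite /k /=; case: (leqP n p.+1) => [np|pn'].
    by rewrite (nth_pre n).
  by rewrite [RHS](nth_pre p.+1) ?size_pre// ltnW.
exists k, (fun n => size (pre n)); split=> // [j|n].
  move=> /finite_seqP[sq sqE].
  (* [B] bounds the supposedly finitely many occurrences of [j], yet [wd B] contains [j] at an index
     beyond [B]. *)
  pose B := \max_(p <- sq) p.
  have jB := wd_all B j; pose p := (size (pre B) + index j (wd B))%N.
  have pB : (p < size (pre B.+1))%N by rewrite preS size_cat ltn_add2l index_mem.
  have kp : k p.+1 = j.
    by rewrite (kE B.+1)// preS nth_cat ltnNge leq_addr /= addKn nth_index.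
  have : [set n | k n = j] p.+1 by [].
  rewrite sqE /= => psq.
  have : (p.+1 <= B)%N by exact: (leq_bigmax_seq (F := id)).
  by rewrite ltnNge (leq_trans (size_pre B))// leq_addr.
suff h p : (p <= size (pre n))%N -> iterates M k z0 p = word M (take p (pre n)) z0.
  by rewrite h// take_size.
elim: p => [|p ih] pn; first by rewrite take0.
by rewrite (take_nth d)// -cats1 word_cat -ih 1?ltnW//= (kE n).
Qed.

End Concatenation.

(** * Divergence when regularity fails *)

Section Divergence.
Context {R : realType} {s : scalar_kind} {H : hilbertType R s}.
Variables (K : nat) (L : 'I_K -> set H).
Hypothesis hL : forall k, closed_subspace (L k).
Hypothesis L0 : trivial_meet L.
Hypothesis K3 : (2 < K)%N.

Lemma third_index (i j : 'I_K) : exists l : 'I_K, l != i /\ l != j.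
Proof.
apply: contrapT => no.
have : ([set: 'I_K] \subset [set i; j])%SET.
  apply/fintype.subsetP => l _; rewrite finset.in_set2.
  apply: contraT; rewrite negb_or => /andP[li lj].
  by exfalso; apply: no; exists l.
move/subset_leq_card; rewrite cardsT card_ord cards2 => /(leq_trans K3).
by case: (i != j).
Qed.

Lemma limit_in_meet (M : 'I_K -> set H) (z0 y : H) (k : nat -> 'I_K) :
    (forall j, closed_subspace (M j)) -> (forall j, M j `<=` L j) ->
    (forall j : 'I_K, infinite_set [set n | k n = j]) ->
    limit (iterates M k z0) y -> y = 0.
Proof.
move=> hM ML hk yl; apply: L0 => j; apply: ML.
have [_ cM] := hM j; apply: ((closed_nrmP _).1 cM) => e /yl[N hN].
have [[//|n] Nn kn] := infinite_index_ge hk j N.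
exists (iterates M k z0 n.+1); last exact/hN/ltnW.
by rewrite -{1}kn; exact: iterates_in.
Qed.

(** The order of choices matters: stage parameters first, then the tolerances [theta], the closeness
    [tau] they require, and only then the tuples. The iterates follow the unit vectors [w n] within
    1/2, while the only possible limit is 0. *)
Lemma not_regular_diverges : ~ regular L -> exists (M : 'I_K -> set H) z0 k,
  [/\ forall j, closed_subspace (M j), forall j, M j `<=` L j,
      forall j : 'I_K, infinite_set [set n | k n = j] &
      ~ cvgn (iterates M k z0)].
Proof.
move=> /(not_regular_almost_common hL) acL.
have K0 : (0 < K)%N by exact: ltn_trans K3.
(* The losses [eta n.+1] of all stages sum to 1/2. *)
pose eta (N : nat) : R := 2^-1 ^+ N.+1.
have eta0 N : 0 < eta N by rewrite exprn_gt0// invr_gt0.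
have KR0 : 0 < K%:R :> R by rewrite ltr0n.
have [k [beta [m [e par]]]] := exists_stage_parameters KR0 eta0.
pose theta := stage_tolerance k e.
have theta0 N : 0 < theta N.
  by rewrite divr_gt0 ?(tolerance_gt0 par)// ltr0n addn_gt0 /coef_count addn1.
(* Stage [n.+1] uses only ranks at least [n], so rank [a] has to respect the finitely many
   tolerances up to [a.+1]. *)
have /choice[tau tauP] a : exists t : R, 0 < t /\ forall N, (N <= a.+1)%N -> t <= theta N / 2.
  have [N|t t0 ht] := @finite_lower_bound R _ (fun N : 'I_(a.+2) => theta N / 2).
    by rewrite divr_gt0.
  by exists t; split=> // N Na; exact: (ht (Ordinal (Na : (N < a.+2)%N))).
have [i [j [u [t [/eqP ij uP]]]]] := exists_spread hL L0 acL K0 (fun a => (tauP a).1).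
have [l [li lj]] := third_index i j.
pose M := spread_subspace i j u k beta.
have hM : forall k', closed_subspace (M k') := spread_subspace_closed i j u k beta.
pose w n := frame k beta (u ^~ l) n.
have w1 n : nrm (w n) = 1.
  have := frame_orthonormal (beta_01 par) (beta_sum par) (spread_orthonormal uP l) n n.
  rewrite inner_self eqxx => /(congr1 (@scalar_re R s)).
  rewrite of_realK -(rmorph1 of_real) of_realK => /eqP.
  by rewrite sqrf_eq1 => /orP[/eqP//|/eqP h]; have := nrm_ge0 (w n); rewrite /w h; lra.
have tau_theta n a : (n <= a)%N -> tau a <= theta n.+1 / 2.
  by move=> na; have [_ h] := tauP a; exact: h.
pose bw n jj := damped_word i j l t (kill_rank k n.+1 jj).
(* The initial pass through [enum 'I_K] makes every letter occur in every stage. *)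
pose wd n := enum 'I_K ++
  flatten [seq flatten (nseq (m n.+1 jj) (bw n jj)) | jj <- iota 0 (k n.+1)].
have count_theta n : (coef_count k n)%:R * theta n.+1 <= e n.+1 /\
    (coef_count k n.+1)%:R * theta n.+1 <= e n.+1.
  have c0 : 0 < (coef_count k n + coef_count k n.+1)%:R :> R.
    by rewrite ltr0n addn_gt0 /coef_count addn1.
  have e0 := tolerance_gt0 par n.+1.
  by rewrite /theta /stage_tolerance /=; split;
    rewrite mulrC mulrAC ler_pdivrMr// ler_pM2l// ler_nat ?leq_addr ?leq_addl.
have near_w n k' : exists2 v, M k' v & nrm (w n - v) <= e n.+1.
  exists (frame k beta (u ^~ k') n).
    exact: (@frame_in_spread_subspace _ _ _ _ i j u k beta k' n).
  apply: le_trans (count_theta n).1; rewrite /w frameB.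
  have tau_le a : (n <= a)%N -> nrm (u a l - u a k') <= theta n.+1.
    move=> na; apply: le_trans (spread_near uP _ _ _) _.
    by apply: le_trans (tau_theta n a na) _; have := theta0 n.+1; lra.
  have amp_le a n' i' : (n <= a)%N -> Num.sqrt (beta n' i') * nrm (u a l - u a k') <= theta n.+1.
    by move=> na; apply: le_trans (tau_le a na); rewrite ler_piMl ?nrm_ge0// (amp_le1 (beta_01 par)).
  apply: (frame_le (beta_01 par) (beta_sum par)) => [i' _|i' _|i' _|i' _|].
  - by apply: amp_le; rewrite leq_kill_rank.
  - by apply: amp_le; rewrite leq_twin_rank.
  - by apply: amp_le; rewrite ltnW// leq_kill_rank.
  - by apply: amp_le; rewrite ltnW// leq_twin_rank.
  - by apply: tau_le; rewrite leq_rest_rank.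
have stage n z : nrm (word M (wd n) z - w n.+1) <= nrm (z - w n) + eta n.+1.
  rewrite /wd word_cat; set z' := word M (enum 'I_K) z.
  have zz' : nrm (z' - w n) <= nrm (z - w n) + K%:R * e n.+1.
    by have := word_near_fixed hM (enum 'I_K) z (near_w n); rewrite size_enum_ord.
  have e0 := tolerance_gt0 par n.+1.
  have run_w : nrm (run (fun jj => word M (bw n jj)) (m n.+1) (k n.+1) (w n) - w n.+1) <=
      (k n.+1)%:R * (eta n.+1 / 3 / (k n.+1)%:R) +
      (1 - cos (pi / 2 / (k n.+1)%:R) ^+ k n.+1).
    apply: (@rotation_run _ _ _ _ _ _ _ (k n.+1) _ (m n.+1) (beta n.+1) (e n.+1)).
    - by rewrite w1.
    - by rewrite w1.
    - exact: steps_gt0 par _.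
    - by move=> jj; exact: word_linear_contraction.
    - exact: beta_01 par _.
    - exact: stage_scales par _.
    - exact: ltW.
    - move=> jj jk; apply: le_trans (count_theta n).1.
      apply: (damped_frame_first uP li lj (beta_01 par) (beta_sum par) jk (tau_theta n)).
        exact: ltW.
      have [oN|oN] := boolP (odd n.+1); [by left|right=> i'; exact: odd_small_pred par _ _ oN].
      have [oN|oN] := boolP (odd n.+1); [by left|right=> i'; exact: odd_small par _ _ oN].
    - move=> jj jk; apply: le_trans (count_theta n).2.
      apply: (damped_frame_second uP li lj (beta_01 par) (beta_sum par) jk (tau_theta n)).
        exact: ltW.
      have [oN|oN] := boolP (odd n.+1); [by left|right=> i'; exact: odd_small_pred par _ _ oN].
      have [oN|oN] := boolP (odd n.+1); [by left|right=> i'; exact: odd_small par _ _ oN].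
  rewrite -word_run in run_w; set rw := flatten _ in run_w *.
  apply: le_trans (nrm_triangle (word M rw (w n)) _ _) _.
  rewrite -wordB//; apply: le_trans (lerD (nrm_word_le hM _ _) run_w) _.
  have : (k n.+1)%:R * (eta n.+1 / 3 / (k n.+1)%:R) = eta n.+1 / 3.
    by rewrite mulrC divfK// pnatr_eq0 -lt0n (steps_gt0 par).
  have := angle_loss par n.+1; have := tolerance_le par n.+1; lra.
have wd_all n k' : k' \in wd n by rewrite mem_cat mem_enum.
have [ks [T [ks_inf nT itT]]] := concatenation M (w 0%N) K0 wd_all.
exists M, (w 0%N), ks; split=> //.
  exact: (spread_subspace_sub hL uP).
move=> /cvg_ex[y /cvgn_limit yl].
have y0 : y = 0.
  apply: (limit_in_meet hM _ ks_inf yl); exact: (spread_subspace_sub hL uP).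
have track n : nrm (iterates M ks (w 0%N) (T n) - w n) <= 2^-1 * (1 - 2^-1 ^+ n).
  elim: n => [|n ih]; first by rewrite itT /= subrr nrm0 expr0 subrr mulr0.
  rewrite itT -[n.+1]addn1 iotaD map_cat flatten_cat word_cat -itT /= cats0 add0n addn1.
  apply: le_trans (stage _ _) _.
  have : eta n.+1 = 2^-1 * (2^-1 * 2^-1 ^+ n) by rewrite /eta !exprS.
  have : (2^-1 : R) ^+ n.+1 = 2^-1 * 2^-1 ^+ n by rewrite exprS.
  move=> -> ->; lra.
have half0 : 0 < (2^-1 : R) by rewrite invr_gt0.
have [N hN] := yl _ half0.
have := hN (T N) (nT N); rewrite y0 subr0.
have := track N; have := ler_dist_nrm (w N) (iterates M ks (w 0%N) (T N)).
rewrite nrm_distC w1; have := exprn_ge0 N (ltW half0); lra.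
Qed.

End Divergence.

(** * The equivalence, by way of regularity *)

Theorem theorem3p7 (R : realType) (s : scalar_kind) (H : hilbertType R s)
    (K : nat) (hK : K = 3%N \/ K = 4%N) (L : 'I_K -> set H)
    (hL : forall k, closed_subspace (L k))
    (hL0 : \bigcap_(k in [set: 'I_K]) L k = [set 0]) :
  [<-> closed (set_sum (fun k => orthocomp (L k)));
       exists C r : R, [/\ 0 < C, 0 <= r, r < 1 &
         forall n : nat,
           (opnorm (iter n (proj_prod L)) <= (C * r ^+ n)%:E)%E];
       forall M : 'I_K -> set H,
         (forall i, closed_subspace (M i)) -> (forall i, M i `<=` L i) ->
         forall (z0 : H) (k : nat -> 'I_K),
           (forall j : 'I_K, infinite_set [set n | k n = j]) ->
           cvgn (iterates M k z0)].
Proof.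
have K3 : (2 < K)%N by case: hK => ->.
have K4 : (K <= 4)%N by case: hK => ->.
have K0 : (0 < K)%N := ltn_trans (ltn0Sn 1) K3.
have L0 : trivial_meet L.
  by move=> x Lx; have : [set 0] x by rewrite -hL0 => k _; exact: Lx.
tfae.
(* The sum is dense, so once closed it is the whole space, which is impossible without
   regularity. *)
- move=> sum_closed; apply: regular_power_decay => //; apply: contrapT => nreg.
  apply: (sum_orthocomp_not_setT hL L0 (not_regular_almost_common hL nreg) K0).
  rewrite -subTset => x _; apply: sum_closed; exact: sum_orthocomp_dense.
- move=> [C [r [C0 r0 r1 hT]]] M hM ML z0 k hk.
  apply: (regular_iterates_cvg hL (ltnW K3) K4 _ hM ML hk).
  exact: power_decay_regular hT.
- move=> conv; have reg : regular L.
    apply: contrapT => /(not_regular_diverges hL L0 K3)[M [z0 [k [hM ML hk]]]].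
    by apply; exact: conv.
  by rewrite regular_sum_setT//; exact: closedT.
Qed.
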